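(* Let $f$ be one of $x^3+3,\ x^3+12,\ x^3+21,\ x^3+3x+3,\ x^3+6x+3,\ x^3+3x^2+3$, let $L$ be its splitting field over $\mathbb{Q}_3$, $E=\mathbb{Q}_3(\alpha)$ for a root $\alpha$ of $f$, $F$ the quadratic subextension, and $H=H_1\otimes_{\mathbb{Q}_3}H_2$ the Hopf Galois structure of cyclic type on $L/\mathbb{Q}_3$ induced from $E$ and $F$. Then: (1) if $f\in\{x^3+3,\ x^3+12,\ x^3+21,\ x^3+3x^2+3\}$, $\mathfrak{A}_H=\mathfrak{A}_{H_1}\otimes_{\mathbb{Z}_3}\mathfrak{A}_{H_2}$; (2) if $f\in\{x^3+3x+3,\ x^3+6x+3\}$, $\mathfrak{A}_H\neq\mathfrak{A}_{H_1}\otimes_{\mathbb{Z}_3}\mathfrak{A}_{H_2}$, and a $\mathbb{Z}_3$-basis of $\mathfrak{A}_H$ is $$\Big\{w_1\eta_1,\ w_1\eta_2,\ w_2\eta_1,\ \tfrac{w_2}{3}(\eta_1+\eta_2),\ w_3\eta_1,\ \tfrac{w_1+w_3}{3}(\eta_1+\eta_2)\Big\}.$$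
   Context: $\mathrm{Gal}(L/\mathbb{Q}_3)=\langle r,s\mid r^3=s^2=1,sr=r^2s\rangle$ with $E=L^{\langle s\rangle}$. $H_1=L[\langle\mu\rangle]^G$ is the unique Hopf Galois structure of $E/\mathbb{Q}_3$, where $\mu$ is left multiplication by $r$ on $G/\langle s\rangle$, $G$ acts on coefficients by Galois action and by $r\mu=\mu$, $s\mu=\mu^{-1}$, and $\langle\sum_kc_k\mu^k,x\rangle=\sum_kc_kr^{-k}(x)$. Its basis: $w_1=\mathrm{Id}$, $w_2=z(\mu-\mu^{-1})$, $w_3=\mu+\mu^{-1}$, where $z\in F$, $z^2\in\mathbb{Q}_3$ and $\{1,z\}$ is a $\mathbb{Z}_3$-basis of $\mathcal{O}_F$. $H_2=\mathbb{Q}_3[\mathrm{Gal}(F/\mathbb{Q}_3)]$ with basis $\eta_1=\mathrm{Id}$, $\eta_2=$ the nontrivial automorphism of $F$. $H=H_1\otimes H_2$ acts on $L=E\otimes F$ by $\langle h_1\otimes h_2,x\otimes y\rangle=\langle h_1,x\rangle\langle h_2,y\rangle$; the elements $w_i\eta_j$ mean $w_i\otimes\eta_j$. Associated orders: $\mathfrak{A}_H=\{h\in H:h\cdot\mathcal{O}_L\subseteq\mathcal{O}_L\}$, similarly $\mathfrak{A}_{H_1}$ for $\mathcal{O}_E$ and $\mathfrak{A}_{H_2}$ for $\mathcal{O}_F$. *)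

(* Defs.v *)
From HB Require Import structures.
From mathcomp Require Import all_boot all_order all_algebra all_fingroup all_field.
Set Implicit Arguments. Unset Strict Implicit. Unset Printing Implicit Defensive.
Import GRing.Theory.
Local Open Scope ring_scope.

(* Axiomatic characterisation of the pair (Q_3, Z_3): a field K with a subring O
   which is a discrete valuation ring with uniformiser 3, residue field of
   3 elements, 3-adically separated and complete.  Such a pair is isomorphic
   to (Q_3, Z_3). *)
Record Q3_structure (K : fieldType) (O : {pred K}) : Prop := {
  Q3_1 : 1 \in O;
  Q3_sub : forall x y, x \in O -> y \in O -> x - y \in O;
  Q3_mul : forall x y, x \in O -> y \in O -> x * y \in O;
  Q3_3nz : (3 : K) != 0;
  Q3_3nu : (3 : K)^-1 \notin O;
  Q3_val : forall x : K, x != 0 ->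
      exists n : int, exists u : K, [/\ u \in O, u^-1 \in O & x = (3 : K) ^ n * u];
  Q3_res : forall x, x \in O -> exists k : nat, (k < 3)%N /\ (x - k%:R) / 3 \in O;
  Q3_sep : forall x : K, (forall n : nat, x / 3 ^+ n \in O) -> x = 0;
  Q3_complete : forall a : nat -> K, (forall n, a n \in O) ->
      (forall n, (a n.+1 - a n) / 3 ^+ n \in O) ->
      exists x : K, forall n, (x - a n) / 3 ^+ n \in O
}.

Section Defs.
Variables (K : fieldType) (O : {pred K}) (L : splittingFieldType K).

Definition integral_over (x : L) : Prop :=
  exists p : {poly K},
    [/\ p \is monic, (forall i, p`_i \in O) & root (map_poly (in_alg L) p) x].

Variables (r s : gal_of (fullv : {vspace L})) (z : L) (E F : {vspace L}).

(* action of w_1 = Id, w_2 = z(mu - mu^-1), w_3 = mu + mu^-1 on E,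
   using <sum c_k mu^k, x> = sum c_k r^{-k}(x) *)
Definition w_act (i : 'I_3) (x : L) : L :=
  match val i with
  | 0%N => x
  | 1%N => z * ((r^-1)%g x - r x)
  | _ => (r^-1)%g x + r x
  end.

(* action of eta_1 = Id, eta_2 = nontrivial automorphism of F (the restriction of s) *)
Definition eta_act (j : 'I_2) (y : L) : L := if val j == 0%N then y else s y.

Definition H1_act (a : 'rV[K]_3) (x : L) : L := \sum_i a 0 i *: w_act i x.
Definition H2_act (b : 'rV[K]_2) (y : L) : L := \sum_j b 0 j *: eta_act j y.

Definition A_H1 (a : 'rV[K]_3) : Prop :=
  forall x, x \in E -> integral_over x -> integral_over (H1_act a x).
Definition A_H2 (b : 'rV[K]_2) : Prop :=
  forall y, y \in F -> integral_over y -> integral_over (H2_act b y).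

(* phi is the action on L = E (x) F of h = sum_{i,j} c_ij w_i eta_j *)
Definition H_acts (c : 'M[K]_(3, 2)) (phi : 'End(L)) : Prop :=
  forall x y, x \in E -> y \in F ->
    phi (x * y) = \sum_i \sum_j c i j *: (w_act i x * eta_act j y).

Definition A_H (c : 'M[K]_(3, 2)) : Prop :=
  exists phi : 'End(L), H_acts c phi /\
    forall l, integral_over l -> integral_over (phi l).

(* image of A_H1 (x)_{Z_3} A_H2 in H = H1 (x) H2 (coefficient matrices) *)
Definition tensor_AH1_AH2 (c : 'M[K]_(3, 2)) : Prop :=
  exists n (a : 'I_n -> 'rV[K]_3) (b : 'I_n -> 'rV[K]_2),
    [/\ forall k, A_H1 (a k), forall k, A_H2 (b k) &
        c = \sum_k (a k)^T *m (b k)].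
End Defs.

Definition i3 (k : nat) : 'I_3 := inord k.
Definition i2 (k : nat) : 'I_2 := inord k.

(* the six claimed basis elements, as coefficient matrices w.r.t. w_i eta_j *)
Definition basisAH (K : fieldType) (k : 'I_6) : 'M[K]_(3, 2) :=
  nth 0 [:: delta_mx (i3 0) (i2 0);
            delta_mx (i3 0) (i2 1);
            delta_mx (i3 1) (i2 0);
            3^-1 *: (delta_mx (i3 1) (i2 0) + delta_mx (i3 1) (i2 1));
            delta_mx (i3 2) (i2 0);
            3^-1 *: (delta_mx (i3 0) (i2 0) + delta_mx (i3 0) (i2 1)
                   + delta_mx (i3 2) (i2 0) + delta_mx (i3 2) (i2 1))]
      k.

(* Main.v *)
Require Import Defs.
From HB Require Import structures.
From mathcomp Require Import all_boot all_order all_algebra all_fingroup all_field.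
From mathcomp Require Import ring.
Set Implicit Arguments. Unset Strict Implicit. Unset Printing Implicit Defensive.
Import GRing.Theory.
Local Open Scope ring_scope.

(* Write x for the root of f in E, y = r x and t = r^2 x, so that z is fixed by r
   and negated by s. As L is the direct sum of E and z E, the w_i commute with
   multiplication by z, and eta_2 is 1 on E and - 1 on z E, the element with
   coefficients c acts on e_0 + z e_1 as h^+ e_0 + z h^- e_1, where
   h^+- = sum_i (c_i0 +- c_i1) w_i. Since 2 is a unit, c is in A_H iff h^+ preserves
   O_E = O[x] and h^- preserves the lattice M of the e in E such that z e is
   integral, while c is in the tensor product iff h^+ and h^- both preserve O_E.

   The discriminant delta^2 of f, with delta in K z, tells whether F is ramified.
   In the unramified case M = O_E. In the ramified cases M is spanned by 1, x and
   x^2 / 3; for f = x^3 + 3 C the vectors 1, x, x^2 are eigenvectors of H_1, so that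
   both lattices have the same stabiliser, while for f = x^3 + 3 B x + 3 with B a
   unit the action of w_2 and w_3 on 1, x, x^2 shows that h preserves M iff its
   coefficients d_i are in O, and O_E iff 3 d_2, 3 d_3 and d_1 - d_3 are. *)

(** * Arithmetic of the 3-adic integers *)

Section Arithmetic.
Variables (K : fieldType) (O : {pred K}) (hK : Q3_structure O).

Lemma Q3_0 : 0 \in O.
Proof. by rewrite -(subrr 1); apply: (Q3_sub hK); apply: Q3_1 hK. Qed.

Lemma Q3_opp x : x \in O -> - x \in O.
Proof. by move=> Ox; rewrite -sub0r; apply: (Q3_sub hK) Ox; apply: Q3_0. Qed.

Lemma Q3_add x y : x \in O -> y \in O -> x + y \in O.
Proof. by move=> Ox Oy; rewrite -[y]opprK; apply: (Q3_sub hK) Ox (Q3_opp Oy). Qed.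

Lemma Q3_natr n : n%:R \in O.
Proof.
elim: n => [|n IHn]; first exact: Q3_0.
by rewrite -natr1; apply: Q3_add IHn (Q3_1 hK).
Qed.

Lemma Q3_exp x n : x \in O -> x ^+ n \in O.
Proof.
move=> Ox; elim: n => [|n IHn]; first exact: Q3_1 hK.
by rewrite exprS; apply: (Q3_mul hK).
Qed.

(** By [Q3_val] the valuation of x is positive, zero or negative, and a negative one would put 3^-1
    in O. *)
Lemma Q3_div3_or_unit x : x \in O -> x / 3 \in O \/ x^-1 \in O.
Proof.
move=> Ox; have [->|x0] := eqVneq x 0; first by left; rewrite mul0r Q3_0.
have [[n|n] [u [Ou Oui def_x]]] := Q3_val hK x0.
  case: n def_x => [|n] def_x; first by right; rewrite def_x mul1r.
  left; rewrite def_x -exprnP exprS.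
  have -> : 3 * 3 ^+ n * u / 3 = 3 ^+ n * u by field; exact: Q3_3nz hK.
  by apply: (Q3_mul hK) Ou; apply/Q3_exp/Q3_natr.
have u0 : u != 0 by apply: contraNneq x0 => u0; rewrite def_x u0 mulr0.
case/negP: (Q3_3nu hK).
have -> : 3^-1 = x * u^-1 * 3 ^+ n :> K.
  rewrite def_x NegzE -exprnN exprS; field.
  by rewrite u0 expf_neq0 (Q3_3nz hK).
by do 2?apply: (Q3_mul hK) => //; apply/Q3_exp/Q3_natr.
Qed.

Lemma Q3_clear_denom x : exists n : nat, 3 ^+ n * x \in O.
Proof.
have [->|x0] := eqVneq x 0; first by exists 0%N; rewrite mulr0 Q3_0.
have [[n|n] [u [Ou _ ->]]] := Q3_val hK x0.
  by exists 0%N; rewrite mul1r; apply: (Q3_mul hK) Ou; apply/Q3_exp/Q3_natr.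
exists n.+1; rewrite NegzE -exprnN mulrA divff ?mul1r //.
by rewrite expf_neq0 ?(Q3_3nz hK).
Qed.

(** An x outside 3 O is a unit, and the hypothesis would then put 3^-1 in O. This recovers the
    divisibility of a coefficient from that of its square or cube. *)
Lemma Q3_div3_dvd x k u : x \in O -> u^-1 \in O -> u != 0 ->
  x ^+ k * u / 3 \in O -> x / 3 \in O.
Proof.
move=> Ox Oui u0 Oxku; case: (Q3_div3_or_unit Ox) => // Oxi.
have [->|x0] := eqVneq x 0; first by rewrite mul0r Q3_0.
case/negP: (Q3_3nu hK).
have -> : 3^-1 = x ^+ k * u / 3 * (x^-1 ^+ k * u^-1).
  by rewrite exprVn; field; rewrite u0 expf_neq0 ?(Q3_3nz hK).
by apply: (Q3_mul hK) => //; apply: (Q3_mul hK) => //; apply: Q3_exp.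
Qed.

Lemma Q3_natr_dvd3 n : (n%:R / 3 \in O) = (3 %| n)%N.
Proof.
have n3 := Q3_3nz hK.
rewrite {1}(divn_eq n 3) /dvdn.
have := ltn_pmod n (isT : 0 < 3)%N; set m := (n %% 3)%N; move: (n %/ 3)%N => k mlt3.
have -> : (k * 3 + m)%:R / 3 = k%:R + m%:R / 3 :> K by rewrite natrD natrM; field.
apply/idP/idP => [Okm | /eqP->]; last by rewrite mul0r addr0 Q3_natr.
have Om : m%:R / 3 \in O.
  have -> : m%:R / 3 = k%:R + m%:R / 3 - k%:R :> K by ring.
  by apply: (Q3_sub hK) Okm (Q3_natr _).
case: m mlt3 Om {Okm} => [|[|[|]]] // _; rewrite ?mul1r => O3.
  by case/negP: (Q3_3nu hK).
case/negP: (Q3_3nu hK); have -> : 3^-1 = 1 - 2 / 3 :> K by field.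
by apply: (Q3_sub hK) O3; apply: Q3_1 hK.
Qed.

Lemma Q3_natr_unit n : ~~ (3 %| n)%N -> n%:R^-1 \in O.
Proof. by rewrite -Q3_natr_dvd3; case: (Q3_div3_or_unit (Q3_natr n)) => [->|]. Qed.

(** Factors 3 are stripped off by strong induction; a number that 3 does not divide cannot vanish in
    K, because 0 / 3 is in O. *)
Lemma Q3_natr_neq0 n : (0 < n)%N -> n%:R != 0 :> K.
Proof.
elim/ltn_ind: n => n IHn n0; have [/dvdnP[m def_n]|ndvd] := boolP (3 %| n)%N.
  have m0 : (0 < m)%N by case: (m) def_n n0 => [->|].
  rewrite def_n natrM; apply: mulf_neq0 (Q3_3nz hK); apply: (IHn m _ m0).
  by rewrite def_n ltn_Pmulr.
by apply: contraNneq ndvd => n_eq0; rewrite -Q3_natr_dvd3 n_eq0 mul0r Q3_0.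
Qed.

Lemma Q3_pchar : [pchar K] =i pred0.
Proof.
move=> p; apply/negP => /andP[p_pr /eqP p0].
by have := Q3_natr_neq0 (prime_gt0 p_pr); rewrite p0 eqxx.
Qed.

(** The last clause excludes 0, whose inverse is 0 by convention. *)
Definition Q3_unit (u : K) := [/\ u \in O, u^-1 \in O & u != 0].

Lemma Q3_natr_is_unit n : ~~ (3 %| n)%N -> Q3_unit n%:R.
Proof.
move=> ndvd; split; [exact: Q3_natr | exact: Q3_natr_unit | apply: Q3_natr_neq0].
by case: n ndvd.
Qed.

Lemma Q3_unitN u : Q3_unit u -> Q3_unit (- u).
Proof. by case=> Ou Oui u0; split; rewrite ?invrN ?oppr_eq0 //; apply: Q3_opp. Qed.

Lemma Q3_unitX n u : Q3_unit u -> Q3_unit (u ^+ n).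
Proof.
by case=> Ou Oui u0; split; rewrite ?expf_neq0 -?exprVn //; apply: Q3_exp.
Qed.

Lemma Q3_unit_mulI u a : Q3_unit u -> u * a \in O -> a \in O.
Proof. by case=> _ Oui u0 Oua; rewrite -[a](mulKf u0); apply: (Q3_mul hK). Qed.

Lemma Q3_unit_div3 u : Q3_unit u -> u / 3 \notin O.
Proof.
case=> _ Oui u0; apply/negP => Ou3; case/negP: (Q3_3nu hK).
by rewrite -[3^-1](mulKf u0); apply: (Q3_mul hK).
Qed.

(** A negative valuation puts w^-1 even in 3 O; the extra factor 3 is what later contradictions rest
    on. *)
Lemma Q3_total w : w \in O \/ w^-1 / 3 \in O.
Proof.
have [->|w0] := eqVneq w 0; first by left; apply: Q3_0.
have [[n|n] [u [Ou Oui def_w]]] := Q3_val hK w0.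
  by left; rewrite def_w; apply: (Q3_mul hK) Ou; apply/Q3_exp/Q3_natr.
have u0 : u != 0 by apply: contraNneq w0 => u0; rewrite def_w u0 mulr0.
right; have -> : w^-1 / 3 = 3 ^+ n * u^-1.
  rewrite def_w NegzE -exprnN exprS; field.
  by rewrite u0 expf_neq0 (Q3_3nz hK).
by apply: (Q3_mul hK) Oui; apply/Q3_exp/Q3_natr.
Qed.

Lemma Q3_sqr_integral w a b : Q3_unit a -> b \in O -> w ^+ 2 * a = b -> w \in O.
Proof.
move=> Ua Ob def_b; have [//|Ow] := Q3_total w; have [Oa Oai a0] := Ua.
have [->|w0] := eqVneq w 0; first exact: Q3_0.
(* With w^-1 in 3 O, the unit a = b w^-2 would be divisible by 3. *)
case/negP: (Q3_unit_div3 Ua).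
have -> : a / 3 = 3 * b * (w^-1 / 3) ^+ 2.
  by rewrite -def_b; field; rewrite w0 (Q3_3nz hK).
by apply: (Q3_mul hK); [apply: (Q3_mul hK) => //; apply: Q3_natr | apply: Q3_exp].
Qed.

Lemma Q3_sqr_unit w a b : Q3_unit a -> Q3_unit b -> w ^+ 2 * a = b -> Q3_unit w.
Proof.
move=> Ua Ub def_b; have [_ _ b0] := Ub.
have w0 : w != 0 by apply: contraNneq b0 => w0; rewrite -def_b w0 expr0n mul0r.
split=> //; first by apply: Q3_sqr_integral Ua _ def_b; case: Ub.
apply: (Q3_sqr_integral (b := a) Ub); first by case: Ua.
by rewrite -def_b exprVn mulKf // expf_neq0.
Qed.

(** The valuation is even on the left and odd on the right. This parity decides later whether F is
    ramified. *)
Lemma Q3_sqr_odd w a b : Q3_unit a -> Q3_unit b -> w ^+ 2 * a <> 3 * b.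
Proof.
move=> Ua Ub def_b; have [[Oa Oai a0] [Ob _ _]] := (Ua, Ub).
have Ow : w \in O.
  by apply: Q3_sqr_integral Ua _ def_b; apply: (Q3_mul hK) Ob; apply: Q3_natr.
have Ow3 : w / 3 \in O.
  apply: (Q3_div3_dvd (k := 2) Ow Oai a0).
  by rewrite def_b mulrC mulKf // (Q3_3nz hK).
case/negP: (Q3_unit_div3 Ub).
have -> : b / 3 = (w / 3) ^+ 2 * a.
  have -> : b = w ^+ 2 * a / 3 by rewrite def_b mulrC mulKf // (Q3_3nz hK).
  by field; exact: Q3_3nz hK.
by apply: (Q3_mul hK) Oa; apply: Q3_exp.
Qed.

Lemma Q3_order01 v : v \in O -> v / 3 ^+ 2 \notin O -> Q3_unit v \/ Q3_unit (v / 3).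
Proof.
move=> Ov Nv9; have n3 := Q3_3nz hK.
have v0 : v != 0 by apply: contraNneq Nv9 => ->; rewrite mul0r Q3_0.
have [Ov3|Ovi] := Q3_div3_or_unit Ov; last by left.
right; split=> //; last by rewrite mulf_neq0 ?invr_eq0.
case: (Q3_div3_or_unit Ov3) => // Ov33; case/negP: Nv9.
by rewrite expr2 invfM mulrA.
Qed.

End Arithmetic.

Ltac Q3_closed hK := repeat first
  [ eassumption
  | simple apply (Q3_natr hK)
  | simple apply (Q3_1 hK)
  | simple apply (Q3_0 hK)
  | simple apply (Q3_exp hK)
  | simple apply (Q3_mul hK)
  | simple apply (Q3_sub hK)
  | simple apply (Q3_opp hK)
  | simple apply (Q3_add hK) ].

(** * Integral elements *)

(* Mentioning the proof in the type makes the ring structure of O inferable. *)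
Definition Q3_int (K : fieldType) (O : {pred K}) of Q3_structure O : {pred K} := O.

Section IntegerRing.
Variables (K : fieldType) (O : {pred K}) (hK : Q3_structure O).

Fact Q3_int_subring_closed : subring_closed (Q3_int hK).
Proof. by split; [apply: Q3_1 hK | apply: Q3_sub hK | apply: Q3_mul hK]. Qed.

HB.instance Definition _ :=
  GRing.isSubringClosed.Build K (Q3_int hK) Q3_int_subring_closed.

(** O as a ring type of its own: integrality over O becomes integrality along a ring morphism into
    L, and closure under sums and products is inherited. *)
Record Q3_integer := Q3Integer {
  Q3_integer_val : K;
  _ : Q3_integer_val \in Q3_int hK }.

HB.instance Definition _ := [isSub for Q3_integer_val].
HB.instance Definition _ := [Choice of Q3_integer by <:].
HB.instance Definition _ := [SubChoice_isSubComNzRing of Q3_integer by <:].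

Variable L : splittingFieldType K.

Definition Q3_integer_in : {rmorphism Q3_integer -> L} := in_alg L \o val.

Lemma integral_overP (x : L) : integral_over O x <-> integralOver Q3_integer_in x.
Proof.
split=> [[p [p_mon Op px]] | [p p_mon px]]; last first.
  exists (map_poly val p); split=> [|i|].
  - by rewrite monic_map.
  - by rewrite coef_map /=; apply: (valP p`_i).
  - by rewrite -map_poly_comp.
pose q : {poly Q3_integer} := \poly_(i < size p) insubd 0 p`_i.
have def_p : map_poly val q = p.
  apply/polyP => i; rewrite coef_map coef_poly.
  case: ltnP => [_|/leq_sizeP->//].
  by rewrite /= insubdK //; apply: Op.
exists q; last by move: px; rewrite -{1}def_p -map_poly_comp.
have inj_val : injective (val : Q3_integer -> K) by apply: val_inj.
apply/eqP/val_inj; rewrite rmorph1 -(eqP p_mon) -def_p.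
by rewrite lead_coef_map_inj // rmorph0.
Qed.

Lemma integral_overD x y :
  integral_over O x -> integral_over O y -> integral_over O (x + y : L).
Proof. by rewrite !integral_overP; apply: integral_add. Qed.

Lemma integral_overB x y :
  integral_over O x -> integral_over O y -> integral_over O (x - y : L).
Proof. by rewrite !integral_overP; apply: integral_sub. Qed.

Lemma integral_overM x y :
  integral_over O x -> integral_over O y -> integral_over O (x * y : L).
Proof. by rewrite !integral_overP; apply: integral_mul. Qed.

Lemma integral_over_nat n : integral_over O (n%:R : L).
Proof. by rewrite integral_overP; apply: integral_nat. Qed.

Lemma integral_overA a : a \in O -> integral_over O (a%:A : L).
Proof.
move=> Oa; rewrite integral_overP.
exact: (integral_id Q3_integer_in (Q3Integer Oa)).
Qed.

Lemma integral_overZ a x :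
  a \in O -> integral_over O (x : L) -> integral_over O (a *: x : L).
Proof. by move=> Oa Ix; rewrite -mulr_algl; apply/integral_overM/Ix/integral_overA. Qed.

Lemma integral_overX x n : integral_over O (x : L) -> integral_over O (x ^+ n : L).
Proof.
move=> Ix; elim: n => [|n IHn]; first exact: (integral_over_nat 1).
by rewrite exprS; apply: integral_overM.
Qed.

Lemma integral_over_root (p : {poly L}) x : p \is monic ->
  (forall i, integral_over O p`_i) -> root p x -> integral_over O (x : L).
Proof.
rewrite integral_overP => p_mon Ip px; apply: integral_root_monic p_mon px _.
by apply/integral_poly => i; rewrite -integral_overP.
Qed.

(** x is a root of X^(n+1) - x^(n+1), a monic polynomial with integral coefficients. *)
Lemma integral_over_pow n x :
  integral_over O (x ^+ n.+1 : L) -> integral_over O (x : L).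
Proof.
move=> Ix; have mon := @monicXnsubC L n.+1 (x ^+ n.+1) isT.
refine (integral_over_root mon _ _).
- move=> i; rewrite coefB coefXn coefC; apply: integral_overB.
    exact: integral_over_nat.
  by case: (i == 0%N); [|apply: (integral_over_nat 0)].
- by rewrite rootE !hornerE subrr.
Qed.

Lemma integral_over_rmorph (g : {lrmorphism L -> L}) x :
  integral_over O x -> integral_over O (g x).
Proof.
case=> p [p_mon Op px]; exists p; split=> //.
have -> : map_poly (in_alg L) p = map_poly g (map_poly (in_alg L) p).
  by rewrite -map_poly_comp; apply: eq_map_poly => a /=; rewrite linearZ rmorph1.
exact: rmorph_root.
Qed.

(** O is integrally closed. The exponent n of a denominator 3^n of a is lowered one at a time; the
    step could fail only if 3 b were a unit, which is refuted. *)
Lemma integral_over_alg a : integral_over O (a%:A : L) <-> a \in O.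
Proof.
split=> [[p [p_mon Op pa]] | ]; last exact: integral_overA.
have {}pa : p.[a] = 0.
  apply: (fmorph_inj (in_alg L)); rewrite rmorph0 -(eqP pa) /=.
  exact/esym/(horner_map (in_alg L)).
have [n Ona] := Q3_clear_denom hK a.
elim: n Ona => [|n IHn]; first by rewrite mul1r.
set b := 3 ^+ n * a in IHn *; rewrite exprS -mulrA -/b => O3b; apply: IHn.
have [] := Q3_div3_or_unit hK O3b.
  by rewrite mulrC mulKf ?(Q3_3nz hK).
move=> O3bi; have n3 := Q3_3nz hK.
have [a0|a0] := eqVneq a 0; first by rewrite /b a0 mulr0 (Q3_0 hK).
have b0 : b != 0 by rewrite mulf_neq0 ?expf_neq0.
(* If a is not in O then a^-1 is in 3 O, while p makes 1 a multiple of a^-1 by an integer. *)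
have Ow : a^-1 / 3 \in O.
  have -> : a^-1 / 3 = (3 * b)^-1 * 3 ^+ n by rewrite /b; field; rewrite a0 n3 expf_neq0.
  by apply: (Q3_mul hK) O3bi _; apply/(Q3_exp hK)/(Q3_natr hK).
have key m (q : {poly K}) : (size q <= m.+1)%N -> (forall i, q`_i \in O) ->
  q.[a] * a^-1 ^+ m \in O.
  move=> szq Oq; rewrite (horner_coef_wide _ szq) mulr_suml.
  elim/big_ind: _ => [||i _]; [exact: Q3_0 hK | exact: Q3_add hK | ].
  have lim : (i <= m)%N by rewrite -ltnS.
  have -> : q`_i * a ^+ i * a^-1 ^+ m = q`_i * (3 * (a^-1 / 3)) ^+ (m - i).
    rewrite mulrCA divff // mulr1 -mulrA; congr (_ * _).
    have -> : a^-1 ^+ m = a^-1 ^+ i * a^-1 ^+ (m - i) by rewrite -exprD subnKC.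
    by rewrite mulrA exprVn divff ?mul1r // expf_neq0.
  apply: (Q3_mul hK) (Oq i) _; apply: (Q3_exp hK).
  by apply: (Q3_mul hK) _ Ow; apply: Q3_natr hK _.
have [m szp] : exists m, size p = m.+1.
  by case: (size p) (monic_neq0 p_mon) (size_poly_eq0 p) => [|m]; [case: eqP | exists m].
case/negP: (Q3_3nu hK).
case: m szp => [|m] szp.
  move/eqP: p_mon pa; rewrite lead_coefE szp => p0.
  by rewrite (size1_polyC (eq_leq szp)) hornerC p0 => /eqP; rewrite oner_eq0.
(* As p vanishes at a, q takes the value a^(m+1) there, so [key] puts a in O; its product with a^-1
   / 3 is 3^-1. *)
pose q := 'X^(m.+1) - p.
have Oq i : q`_i \in O.
  rewrite coefB; apply: (Q3_sub hK); last exact: Op.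
  by rewrite coefXn; apply: Q3_natr hK _.
have szq : (size q <= m.+1)%N.
  apply/leq_sizeP => i; rewrite leq_eqVlt => /orP[/eqP<-|lt_mi].
    by rewrite coefB coefXn eqxx -[m.+1]/(m.+2.-1) -szp -lead_coefE (eqP p_mon) subrr.
  by rewrite coefB coefXn gtn_eqF // nth_default ?subrr // szp.
have := key m q szq Oq; rewrite /q !hornerE pa subr0 => Oa.
have -> : 3^-1 = a ^+ m.+1 * a^-1 ^+ m * (a^-1 / 3).
  by rewrite exprS exprVn; field; rewrite a0 n3 expf_neq0.
exact: (Q3_mul hK).
Qed.

End IntegerRing.

Ltac integrality hK := repeat first
  [ eassumption
  | simple apply (integral_overA hK)
  | simple apply (integral_overX hK)
  | simple apply (integral_overM hK)
  | simple apply (integral_overB hK)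
  | simple apply (integral_overD hK)
  | simple apply (integral_over_nat hK) ].

(** * Integers of a cubic Eisenstein extension *)

Section CubicRoots.
Variables (L : fieldType) (a b c x y t : L).
Hypotheses (x3 : x ^+ 3 = - (a * x ^+ 2 + b * x + c))
  (y3 : y ^+ 3 = - (a * y ^+ 2 + b * y + c)).

(** The difference of the two cubic equations is divisible by y - x, and this is the quotient. *)
Lemma cubic_second_root : y != x -> y ^+ 2 = - (x ^+ 2 + x * y + a * (x + y) + b).
Proof. by rewrite -subr_eq0 => nyx; apply: (mulfI nyx); ring: x3 y3. Qed.

Lemma cubic_third_root :
  y ^+ 2 = - (x ^+ 2 + x * y + a * (x + y) + b) ->
  t ^+ 2 = - (x ^+ 2 + x * t + a * (x + t) + b) ->
  t != y -> t = - (a + x + y).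
Proof. by move=> y2 t2; rewrite -subr_eq0 => nty; apply: (mulfI nty); ring: y2 t2. Qed.

Lemma cubic_discriminant :
  y ^+ 2 = - (x ^+ 2 + x * y + a * (x + y) + b) -> t = - (a + x + y) ->
  ((x - y) * (y - t) * (t - x)) ^+ 2 =
    a ^+ 2 * b ^+ 2 - 4 * b ^+ 3 - 4 * a ^+ 3 * c - 27 * c ^+ 2 + 18 * a * b * c.
Proof. by move=> y2 tE; ring: x3 y2 tE. Qed.

(** Both the root of the discriminant and t - y change sign when y and t are exchanged, so their
    product is a polynomial in x alone. *)
Lemma depressed_cubic_delta : a = 0 ->
  y ^+ 2 = - (x ^+ 2 + x * y + a * (x + y) + b) -> t = - (a + x + y) ->
  (x - y) * (y - t) * (t - x) * (t - y) = - (4 * b ^+ 2 - 9 * c * x + 6 * b * x ^+ 2).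
Proof. by move=> a0 y2 tE; ring: a0 x3 y2 tE. Qed.

End CubicRoots.

Section EisensteinCubic.
Variables (K : fieldType) (O : {pred K}) (hK : Q3_structure O).
Variables (L : splittingFieldType K) (A B C : nat) (x y t : L).
Hypotheses (C_ndvd3 : ~~ (3 %| C)%N)
  (x3 : x ^+ 3 = - (3 * A%:R * x ^+ 2 + 3 * B%:R * x + 3 * C%:R))
  (y2 : y ^+ 2 = - (x ^+ 2 + x * y + 3 * A%:R * (x + y) + 3 * B%:R))
  (tE : t = - (3 * A%:R + x + y)).

Local Notation I := (integral_over O).

Let n3K : (3 : K) != 0 := Q3_3nz hK.
Let n3L : (3 : L) != 0.
Proof. by rewrite -(rmorph_nat (in_alg L)) fmorph_eq0. Qed.

Lemma cubic_root_integral u :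
  u ^+ 3 = - (3 * A%:R * u ^+ 2 + 3 * B%:R * u + 3 * C%:R) -> I (u : L).
Proof.
move=> pu; pose p : {poly L} := Poly [:: 3 * C%:R; 3 * B%:R; 3 * A%:R; 1].
have def_p : p = [:: 3 * C%:R; 3 * B%:R; 3 * A%:R; 1] :> seq L.
  by apply: (@PolyK _ 0); apply: oner_neq0.
refine (integral_over_root hK (p := p) _ _ _).
- by rewrite /monic_pred monicE lead_coefE def_p.
- move=> i; rewrite def_p -!natrM.
  case: i => [|[|[|[|i]]]] /=; rewrite ?nth_nil; try exact: (integral_over_nat hK).
    exact: (integral_over_nat hK L 1).
  exact: (integral_over_nat hK L 0).
- rewrite /root horner_Poly /=; apply/eqP; ring: pu.
Qed.

Lemma root1_integral : I x. Proof. exact: cubic_root_integral x3. Qed.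
Lemma root2_integral : I y.
Proof. by apply: cubic_root_integral; ring: x3 y2. Qed.
Lemma root3_integral : I t.
Proof. by apply: cubic_root_integral; ring: x3 y2 tE. Qed.

(** All lower coefficients are multiples of 3, so the equation can be divided by 3. In effect u has
    valuation 1/3. *)
Lemma cube_div3_integral u :
  u ^+ 3 = - (3 * A%:R * u ^+ 2 + 3 * B%:R * u + 3 * C%:R) -> I (u ^+ 3 / 3 : L).
Proof.
move=> pu; have Iu := cubic_root_integral pu.
have -> : u ^+ 3 / 3 = 0 - (A%:R * u ^+ 2 + B%:R * u + C%:R) by field: pu.
apply: (integral_overB hK); first exact: (integral_over_nat hK L 0).
do 2?apply: (integral_overD hK); try apply: (integral_overM hK);
  by [apply: (integral_over_nat hK) | apply: (integral_overX hK) | ].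
Qed.

(** x^2 / 3 has valuation -1/3, which c must compensate. The exponents are chosen so that the
    product with conjugates lands in K, with a single 3 left in the denominator. *)
Lemma Eisenstein_x2 c : c \in O -> I (c%:A * x ^+ 2 / 3) -> c / 3 \in O.
Proof.
move=> Oc Ic; apply: (Q3_div3_dvd hK (k := 3) (u := C%:R ^+ 6)) => //.
- by rewrite -exprVn; apply/(Q3_exp hK)/(Q3_natr_unit hK).
- by rewrite expf_neq0 // (Q3_natr_neq0 hK) //; case: (C) C_ndvd3.
apply/(integral_over_alg hK L).
(* x^3 / 3, y^3 / 3 and t^3 / 3 are integers with product - C^3. *)
have yr : y ^+ 3 = - (3 * A%:R * y ^+ 2 + 3 * B%:R * y + 3 * C%:R) by ring: x3 y2 tE.
have tr : t ^+ 3 = - (3 * A%:R * t ^+ 2 + 3 * B%:R * t + 3 * C%:R) by ring: x3 y2 tE.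
have -> : (c ^+ 3 * C%:R ^+ 6 / 3)%:A =
    (c%:A * x ^+ 2 / 3) ^+ 3 * ((y ^+ 3 / 3) ^+ 2 * (t ^+ 3 / 3) ^+ 2).
  rewrite -!in_algE.
  have xyt6 : x ^+ 6 * y ^+ 6 * t ^+ 6 = 3 ^+ 6 * C%:R ^+ 6.
    have xyt : x * y * t = - (3 * C%:R) by ring: x3 y2 tE.
    by rewrite -!exprMn xyt; ring.
  by field: xyt6.
apply: (integral_overM hK); first exact: (integral_overX hK).
by apply: (integral_overM hK); apply: (integral_overX hK); apply: cube_div3_integral.
Qed.

(** The valuations 0, 1/3, 2/3 of 1, x, x^2 are distinct modulo 1, so the coefficients are treated
    one by one, starting from a. *)
Lemma Eisenstein_div3 a b c : a \in O -> b \in O -> c \in O ->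
  I ((a%:A + b%:A * x + c%:A * x ^+ 2) / 3) ->
  [/\ a / 3 \in O, b / 3 \in O & c / 3 \in O].
Proof.
move=> Oa Ob Oc Iabc; have Ix3 := cube_div3_integral x3.
have [[Ia Ib] Ic] := (integral_overA hK L Oa, integral_overA hK L Ob, integral_overA hK L Oc).
have I3 := integral_over_nat hK L 3; have Ix1 := root1_integral.
(* The expression (a + g)^3 / 3 is integral, and so are a g (a + g) and, since x divides g, g^3 / 3;
   what remains is a^3 / 3. *)
have {Ia} Oa3 : a / 3 \in O.
  apply: (Q3_div3_dvd hK (k := 3) (u := 1)); rewrite ?invr1 ?oner_eq0 ?(Q3_1 hK) //.
  apply/(integral_over_alg hK L); pose g := b%:A * x + c%:A * x ^+ 2.
  have Ig : I g by apply: (integral_overD hK); do ?apply: (integral_overM hK).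
  have -> : (a ^+ 3 * 1 / 3)%:A =
      ((a%:A + b%:A * x + c%:A * x ^+ 2) / 3) ^+ 3 * 3 ^+ 2
      - (a%:A * g * (a%:A + g) + x ^+ 3 / 3 * (b%:A + c%:A * x) ^+ 3).
    by rewrite /g -!in_algE; field.
  by integrality hK.
have Ia3 := integral_overA hK L Oa3.
have Ibc : I ((b%:A * x + c%:A * x ^+ 2) / 3).
  have -> : (b%:A * x + c%:A * x ^+ 2) / 3 =
     (a%:A + b%:A * x + c%:A * x ^+ 2) / 3 - (a / 3)%:A :> L.
    by rewrite -!in_algE; field.
  exact: (integral_overB hK).
(* Multiplication by x turns c x^2 / 3 into an integer and leaves b x^2 / 3. *)
have {}Ib : b / 3 \in O.
  apply: Eisenstein_x2 => //.
  have -> : b%:A * x ^+ 2 / 3 =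
     (b%:A * x + c%:A * x ^+ 2) / 3 * x - c%:A * (x ^+ 3 / 3) by field.
  by integrality hK.
split=> //; apply: Eisenstein_x2 => //.
have Ib3 := integral_overA hK L Ib.
have -> : c%:A * x ^+ 2 / 3 =
   (b%:A * x + c%:A * x ^+ 2) / 3 - (b / 3)%:A * x :> L.
  by rewrite -!in_algE; field.
by integrality hK.
Qed.

(** Induction on a common denominator 3^n: P holds for the cleared coordinates, and the first
    hypothesis removes one factor 3 at a time. The predicate is abstract because both lattices O_E
    and M use it. *)
Lemma Q3_descent (P : K -> K -> K -> Prop) :
  (forall a b c, a \in O -> b \in O -> c \in O -> P (a / 3) (b / 3) (c / 3) ->
    [/\ a / 3 \in O, b / 3 \in O & c / 3 \in O]) ->
  (forall a b c, P a b c -> P (3 * a) (3 * b) (3 * c)) ->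
  forall a b c, P a b c -> [/\ a \in O, b \in O & c \in O].
Proof.
move=> P_div3 P_mul3 a b c Pabc.
have [[[i Oa] [j Ob]] [k Oc]] :=
  (Q3_clear_denom hK a, Q3_clear_denom hK b, Q3_clear_denom hK c).
have O3 m : 3 ^+ m \in O by apply/(Q3_exp hK)/(Q3_natr hK).
have Pn n : P (3 ^+ n * a) (3 ^+ n * b) (3 ^+ n * c).
  by elim: n => [|n /P_mul3]; rewrite ?mul1r // exprS -!mulrA.
have : exists n, [/\ 3 ^+ n * a \in O, 3 ^+ n * b \in O & 3 ^+ n * c \in O].
  exists (i + j + k)%N; split.
  - have -> : 3 ^+ (i + j + k) * a = 3 ^+ j * 3 ^+ k * (3 ^+ i * a) by rewrite !exprD; ring.
    exact: (Q3_mul hK (Q3_mul hK (O3 _) (O3 _)) Oa).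
  - have -> : 3 ^+ (i + j + k) * b = 3 ^+ i * 3 ^+ k * (3 ^+ j * b) by rewrite !exprD; ring.
    exact: (Q3_mul hK (Q3_mul hK (O3 _) (O3 _)) Ob).
  - have -> : 3 ^+ (i + j + k) * c = 3 ^+ i * 3 ^+ j * (3 ^+ k * c) by rewrite !exprD; ring.
    exact: (Q3_mul hK (Q3_mul hK (O3 _) (O3 _)) Oc).
case; elim=> [|n IHn]; rewrite ?mul1r // !exprS -!mulrA => -[Oan Obn Occn].
have div3 (u : K) : 3 * u / 3 = u by field.
by apply: IHn; have := P_div3 _ _ _ Oan Obn Occn; rewrite !div3; apply.
Qed.

Lemma Eisenstein_integralE a b c :
  I (a%:A + b%:A * x + c%:A * x ^+ 2) <-> [/\ a \in O, b \in O & c \in O].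
Proof.
split=> [|[Oa Ob Oc]]; last first.
  by have Ix1 := root1_integral; integrality hK.
apply: (@Q3_descent (fun a b c => I (a%:A + b%:A * x + c%:A * x ^+ 2))) => {a b c}.
  move=> a b c Oa Ob Oc Iabc; apply: Eisenstein_div3 => //.
  suff -> : (a%:A + b%:A * x + c%:A * x ^+ 2) / 3 =
    (a / 3)%:A + (b / 3)%:A * x + (c / 3)%:A * x ^+ 2 by [].
  by rewrite -!in_algE; field.
move=> a b c Iabc.
have -> : (3 * a)%:A + (3 * b)%:A * x + (3 * c)%:A * x ^+ 2 =
   3 * (a%:A + b%:A * x + c%:A * x ^+ 2) by rewrite -!in_algE; ring.
exact: (integral_overM hK) (integral_over_nat hK L 3) Iabc.
Qed.

(** This is the lattice M. As z has valuation 1/2, z x^2 / 3 has valuation 1/6 and is integral,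
    while z / 3 and z x / 3 have negative valuation. *)
Lemma Eisenstein_ramifiedE (z : L) (v : K) a b c :
  v \in O -> v^-1 \in O -> v != 0 -> z ^+ 2 = (3 * v)%:A ->
  I (z * (a%:A + b%:A * x + c%:A * x ^+ 2)) <->
    [/\ a \in O, b \in O & 3 * c \in O].
Proof.
move=> Ov Ovi v0 z2; have Iv := integral_overA hK L Ov.
have I3 := integral_over_nat hK L 3; have Ix1 := root1_integral.
have O3 := Q3_natr hK 3.
have Iz : I z.
  apply: (integral_over_pow hK (n := 1)); rewrite z2; apply: (integral_overA hK).
  exact: (Q3_mul hK).
have Ix3 := cube_div3_integral x3.
have Izx2 : I (z * (x ^+ 2 / 3)).
  apply: (integral_over_pow hK (n := 2)).
  have -> : (z * (x ^+ 2 / 3)) ^+ 3 = z * v%:A * (x ^+ 3 / 3) ^+ 2.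
    have {}z2 : z ^+ 2 = 3 * v%:A by rewrite z2 -!in_algE; ring.
    by field: z2.
  by integrality hK.
split=> [|[Oa Ob Oc]]; last first.
  have -> : z * (a%:A + b%:A * x + c%:A * x ^+ 2) =
     z * (a%:A + b%:A * x) + (3 * c)%:A * (z * (x ^+ 2 / 3)) by rewrite -!in_algE; field.
  by integrality hK.
(* The descent runs on the coordinates a, b, 3 c with respect to 1, x, x^2 / 3. *)
pose P a b c := I (z * (a%:A + b%:A * x + (c / 3)%:A * x ^+ 2)).
have def_c : c = 3 * c / 3 by field.
rewrite [in X in I X]def_c => Pabc.
apply: (Q3_descent _ _ (Pabc : P a b (3 * c))) => {a b c def_c Pabc} a b c; last first.
  rewrite /P => Pabc.
  have -> : z * ((3 * a)%:A + (3 * b)%:A * x + (3 * c / 3)%:A * x ^+ 2) =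
    3 * (z * (a%:A + b%:A * x + (c / 3)%:A * x ^+ 2)) by rewrite -!in_algE; field.
  exact: (integral_overM hK).
move=> Oa Ob Oc Pabc.
have z2' : z ^+ 2 = 3 * in_alg L v by rewrite z2 -!in_algE; ring.
have [[Ia Ib] Ic] := (integral_overA hK L Oa, integral_overA hK L Ob, integral_overA hK L Oc).
(* A second factor z gives z^2 = 3 v and an element of O_E, whose coordinates are known. *)
have Oc3 : c / 3 \in O.
  have : I ((v * a)%:A + (v * b)%:A * x + (v * (c / 3))%:A * x ^+ 2).
    have -> : (v * a)%:A + (v * b)%:A * x + (v * (c / 3))%:A * x ^+ 2 =
      z * (z * ((a / 3)%:A + (b / 3)%:A * x + (c / 3 / 3)%:A * x ^+ 2)).
      by rewrite -!in_algE; field: z2'.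
    exact: (integral_overM hK).
  case/Eisenstein_integralE=> _ _ Ovc.
  by rewrite -[c / 3](mulKf v0); apply: (Q3_mul hK).
have Iab : I (z * (a%:A + b%:A * x) / 3).
  have -> : z * (a%:A + b%:A * x) / 3 =
    z * ((a / 3)%:A + (b / 3)%:A * x + (c / 3 / 3)%:A * x ^+ 2)
     - (c / 3)%:A * (z * (x ^+ 2 / 3)) by rewrite -!in_algE; field.
  by integrality hK.
(* The cube of z (a + b x) / 3, times z, is v^2 (a + g)^3 / 3, from which a^3 v^2 / 3 is
   isolated. *)
have Oa3 : a / 3 \in O.
  apply: (Q3_div3_dvd hK (k := 3) (u := v ^+ 2)); rewrite ?expf_neq0 -?exprVn //.
    exact: (Q3_exp hK).
  apply/(integral_over_alg hK L); pose g := b%:A * x.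
  have Ig : I g by apply: (integral_overM hK).
  have -> : (a ^+ 3 * v ^+ 2 / 3)%:A =
      (z * (a%:A + b%:A * x) / 3) ^+ 3 * z
       - v%:A ^+ 2 * (a%:A * g * (a%:A + g) + x ^+ 3 / 3 * b%:A ^+ 3).
    by rewrite /g -!in_algE; field: z2'.
  by integrality hK.
(* The square of z b x / 3 is v b^2 x^2 / 3, to which [Eisenstein_x2] applies. *)
split=> //; apply: (Q3_div3_dvd hK (k := 2) (u := v)) => //.
have -> : b ^+ 2 * v / 3 = v * b ^+ 2 / 3 by rewrite [v * _]mulrC.
apply: Eisenstein_x2; first by apply: (Q3_mul hK) Ov _; apply: (Q3_exp hK).
have -> : (v * b ^+ 2)%:A * x ^+ 2 / 3 =
    (z * (a%:A + b%:A * x) / 3 - z * (a / 3)%:A) ^+ 2.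
  by rewrite -!in_algE; field: z2'.
by integrality hK.
Qed.

End EisensteinCubic.

(** * The coefficient matrices *)

Lemma val_i3 k : (k < 3)%N -> val (i3 k) = k. Proof. exact: inordK. Qed.

Lemma val_i2 k : (k < 2)%N -> val (i2 k) = k. Proof. exact: inordK. Qed.

Lemma ord2P (j : 'I_2) : j = i2 0 \/ j = i2 1.
Proof.
by case: j => [[|[|//]] lt_j]; [left | right]; apply/val_inj; rewrite val_i2.
Qed.

Lemma ord3P (i : 'I_3) : [\/ i = i3 0, i = i3 1 | i = i3 2].
Proof.
case: i => [[|[|[|//]]] lt_i]; [apply: Or31 | apply: Or32 | apply: Or33];
  by apply/val_inj; rewrite val_i3.
Qed.

Lemma big_ord3 (V : nmodType) (G : 'I_3 -> V) :
  \sum_i G i = G (i3 0) + G (i3 1) + G (i3 2).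
Proof.
rewrite !big_ord_recr big_ord0 /= add0r.
by congr (G _ + G _ + G _); apply/val_inj; rewrite /= inordK.
Qed.

Lemma big_ord2 (V : nmodType) (G : 'I_2 -> V) : \sum_i G i = G (i2 0) + G (i2 1).
Proof.
rewrite !big_ord_recr big_ord0 /= add0r.
by congr (G _ + G _); apply/val_inj; rewrite /= inordK.
Qed.

Lemma big_ord6 (V : nmodType) (G : 'I_6 -> V) : \sum_i G i =
  G (inord 0) + G (inord 1) + G (inord 2) + G (inord 3) + G (inord 4) + G (inord 5).
Proof.
rewrite !big_ord_recr big_ord0 /= add0r.
by congr (G _ + G _ + G _ + G _ + G _ + G _); apply/val_inj; rewrite /= inordK.
Qed.

Lemma basisAH_sum (K : fieldType) (lam : 'I_6 -> K) (l := fun k => lam (inord k))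
    (c := \sum_k lam k *: basisAH K k) :
  [/\ c (i3 0) (i2 0) = l 0%N + l 5%N / 3, c (i3 0) (i2 1) = l 1%N + l 5%N / 3,
      c (i3 1) (i2 0) = l 2%N + l 3%N / 3, c (i3 1) (i2 1) = l 3%N / 3 &
      c (i3 2) (i2 0) = l 4%N + l 5%N / 3 /\ c (i3 2) (i2 1) = l 5%N / 3].
Proof.
rewrite /c big_ord6 /basisAH !inordK //= -/(l 0%N) -/(l 1%N) -/(l 2%N) -/(l 3%N)
  -/(l 4%N) -/(l 5%N) !mxE -!val_eqE !val_i3 // !val_i2 //=.
by split; [ring | ring | ring | ring | split; ring].
Qed.

Lemma basisAH_free (K : fieldType) (lam : 'I_6 -> K) : (3 : K) != 0 ->
  \sum_k lam k *: basisAH K k = 0 -> forall k, lam k = 0.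
Proof.
move=> n3 lam0; have [] := basisAH_sum lam; rewrite lam0 !mxE.
move=> e0 e1 e2 e3 [e4 e5].
have cancel3 (a : K) : 0 = a / 3 -> a = 0.
  by move/esym/eqP; rewrite mulf_eq0 invr_eq0 (negPf n3) orbF => /eqP.
have {}e5 := cancel3 _ e5; have {}e3 := cancel3 _ e3.
move: e0 e1 e2 e4; rewrite e5 e3 mul0r !addr0 => e0 e1 e2 e4 k.
have -> : k = inord (val k) by rewrite inord_val.
by case: k => [[|[|[|[|[|[|//]]]]]] ltk].
Qed.

(** * The Hopf-Galois action *)

Section GaloisSetup.
Variables (K : fieldType) (O : {pred K}) (hK : Q3_structure O).
Variables (L : splittingFieldType K) (A B C : nat) (x : L).
Variables (r s : gal_of (fullv : {vspace L})).
Hypotheses (C_ndvd3 : ~~ (3 %| C)%N)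
  (x3 : x ^+ 3 = - (3 * A%:R * x ^+ 2 + 3 * B%:R * x + 3 * C%:R)).
Hypotheses (hr : #[r]%g = 3%N) (hs : #[s]%g = 2%N) (hsr : (s * r = r ^+ 2 * s)%g)
  (hgen : <<[set r; s]>>%g = 'Gal(fullv / 1%VS)%g)
  (hE : <<1; x>>%VS = fixedField <[s]>%g).

Local Notation I := (integral_over O).
Local Notation E := <<1; x>>%VS.
Let y := r x.
Let t := r (r x).

Let n3K : (3 : K) != 0 := Q3_3nz hK.

Lemma scale_alg (k : K) (u : L) : k *: u = in_alg L k * u.
Proof. by rewrite mulr_algl. Qed.

Lemma natrL_neq0 n : (0 < n)%N -> n%:R != 0 :> L.
Proof. by move=> n0; rewrite -(rmorph_nat (in_alg L)) fmorph_eq0 (Q3_natr_neq0 hK). Qed.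

Let n3L : (3 : L) != 0 := natrL_neq0 (isT : 0 < 3)%N.
Let n2L : (2 : L) != 0 := natrL_neq0 (isT : 0 < 2)%N.

Lemma r_cubed u : r (r (r u)) = u.
Proof.
have r3 : (r * r * r = 1)%g by rewrite -(expg_order r) hr !expgS expg0 mulg1 mulgA.
by rewrite -!galM ?memvf // mulgA r3 gal_id.
Qed.

Lemma s_squared u : s (s u) = u.
Proof.
have s2 : (s * s = 1)%g by rewrite -(expg_order s) hs !expgS expg0 mulg1.
by rewrite -galM ?memvf // s2 gal_id.
Qed.

Lemma r_inverse u : (r^-1)%g u = r (r u).
Proof. by rewrite -{1}[u]r_cubed -galM ?memvf // mulgV gal_id. Qed.

Lemma s_r u : s (r u) = r (r (s u)).
Proof.
have rs u' : r (s u') = s (r (r u')).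
  by rewrite -!galM ?memvf // mulgA -expg2 -hsr galM ?memvf.
by rewrite -{1}[u]r_cubed -!rs.
Qed.

(** Characteristic 0 makes L / K Galois, and r and s generate its group. *)
Lemma fixed_rs u : r u = u -> s u = u -> u \in 1%VS.
Proof.
move=> ru su; have sep : separable 1%AS {:L}%AS.
  apply/separableP => w _; apply: pcharf0_separable => p.
  by rewrite (fmorph_pchar (in_alg L)); apply: Q3_pchar hK p.
have gal1 : galois 1%AS {:L}%AS by rewrite /galois sub1v sep normalFieldf.
have := gal_generated [set r; s]; rewrite hgen => gal_rs.
have /galois_fixedField <- := gal1.
rewrite -gal_rs; have /galois_fixedField -> := fixedField_galois [set r; s].
by apply/fixedFieldP; rewrite ?memvf // => g /set2P[]->.
Qed.

Lemma mem_E u : u \in E <-> s u = u.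
Proof.
rewrite hE; split=> [/mem_fixedFieldP[_ fix_u]|su]; first exact/fix_u/cycle_id.
apply/fixedFieldP=> [|_ /cycleP[i ->]]; first exact: memvf.
elim: i => [|i IHi]; first by rewrite expg0 gal_id.
by rewrite expgS galM ?memvf // su.
Qed.

Lemma s_x : s x = x.
Proof. exact/mem_E/memv_adjoin. Qed.

Lemma root_gal (g : gal_of (fullv : {vspace L})) u :
  u ^+ 3 = - (3 * A%:R * u ^+ 2 + 3 * B%:R * u + 3 * C%:R) ->
  g u ^+ 3 = - (3 * A%:R * g u ^+ 2 + 3 * B%:R * g u + 3 * C%:R).
Proof. by move=> u3; rewrite -rmorphXn u3 rmorphN !rmorphD !rmorphM ?rmorphXn !rmorph_nat. Qed.

(** Eisenstein's argument: a root in K would lie in 3 O, and the equation divided by 9 would then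
    make 3 divide C. *)
Lemma root_notin_K : x \notin 1%VS.
Proof.
apply/negP => /vlineP[a def_x].
have a3 : a ^+ 3 = - (3 * A%:R * a ^+ 2 + 3 * B%:R * a + 3 * C%:R).
  apply: (fmorph_inj (in_alg L)); have := x3; rewrite def_x -!in_algE => a3.
  by rewrite rmorphXn a3 rmorphN !rmorphD !rmorphM ?rmorphXn !rmorph_nat.
have Oa : a \in O.
  by apply/(integral_over_alg hK L); rewrite -def_x; apply: cubic_root_integral x3.
have Oa3 : a / 3 \in O.
  apply: (Q3_div3_dvd hK (k := 3) (u := 1)); rewrite ?invr1 ?oner_eq0 ?(Q3_1 hK) //.
  have -> : a ^+ 3 * 1 / 3 = - (A%:R * a ^+ 2 + B%:R * a + C%:R) by field: a3.
  by Q3_closed hK.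
move: C_ndvd3; rewrite -(Q3_natr_dvd3 hK) => /negP; apply.
have -> : C%:R / 3 = - (3 * (a / 3) ^+ 3 + 3 * A%:R * (a / 3) ^+ 2 + B%:R * (a / 3)).
  by field: a3.
by Q3_closed hK.
Qed.

Lemma y_neq_x : y != x.
Proof. by apply: contra root_notin_K => /eqP rx; apply: fixed_rs s_x. Qed.

Lemma t_neq_x : t != x.
Proof. by apply: contra y_neq_x => /eqP tx; rewrite /y -{1}tx r_cubed. Qed.

Lemma t_neq_y : t != y.
Proof.
by apply: contra t_neq_x => /eqP/(congr1 r); rewrite /t /y r_cubed => <-.
Qed.

Lemma y2 : y ^+ 2 = - (x ^+ 2 + x * y + 3 * A%:R * (x + y) + 3 * B%:R).
Proof. exact: cubic_second_root x3 (root_gal r x3) y_neq_x. Qed.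

Lemma t2 : t ^+ 2 = - (x ^+ 2 + x * t + 3 * A%:R * (x + t) + 3 * B%:R).
Proof. exact: cubic_second_root x3 (root_gal r (root_gal r x3)) t_neq_x. Qed.

Lemma tE : t = - (3 * A%:R + x + y).
Proof. exact: cubic_third_root y2 t2 t_neq_y. Qed.

Lemma ry : r y = t. Proof. by []. Qed.
Lemma rt : r t = x. Proof. exact: r_cubed. Qed.
Lemma sy : s y = t. Proof. by rewrite /y s_r s_x. Qed.
Lemma st : s t = y. Proof. by rewrite -sy s_squared. Qed.

Definition delta := (x - y) * (y - t) * (t - x).

Lemma delta_neq0 : delta != 0.
Proof.
rewrite !mulf_neq0 // subr_eq0 ?t_neq_x //; first by rewrite eq_sym y_neq_x.
by rewrite eq_sym t_neq_y.
Qed.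

Lemma r_delta : r delta = delta.
Proof.
have -> : r delta = (r x - r y) * (r y - r t) * (r t - r x).
  by rewrite /delta !rmorphM !rmorphB.
by rewrite ry rt -/y /delta; ring.
Qed.

Lemma s_delta : s delta = - delta.
Proof.
have -> : s delta = (s x - s y) * (s y - s t) * (s t - s x).
  by rewrite /delta !rmorphM !rmorphB.
by rewrite s_x sy st /delta; ring.
Qed.

Lemma E_span u : u \in E -> exists a b c, u = a%:A + b%:A * x + c%:A * x ^+ 2.
Proof.
case/Fadjoin_polyP => p /polyOverP p1 ->; rewrite horner_coef.
pose P (u : L) := exists a b c, u = a%:A + b%:A * x + c%:A * x ^+ 2.
rewrite -/(P _); elim/big_ind: _ => [|u1 u2|i _].
- by exists 0, 0, 0; rewrite -!in_algE; ring.
- case=> [a1 [b1 [c1 ->]]] [a2 [b2 [c2 ->]]].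
  by exists (a1 + a2), (b1 + b2), (c1 + c2); rewrite -!in_algE; ring.
case/vlineP: (p1 i) => a ->.
suff [a' [b' [c' ->]]] : P (x ^+ i).
  by exists (a * a'), (a * b'), (a * c'); rewrite -!in_algE; ring.
elim: (val i) => [|n [a' [b' [c' IHn]]]].
  by exists 1, 0, 0; rewrite -!in_algE; ring.
(* Multiplication by x, with x^3 reduced by the cubic equation. *)
exists (- (3 * C%:R * c')), (a' - 3 * B%:R * c'), (b' - 3 * A%:R * c').
by rewrite exprSr IHn -!in_algE; ring: x3.
Qed.

(** Here [delta] plays the part of z, which is not yet available, and yields L = E + delta E. *)
Lemma anti_span u : s u = - u -> exists2 e, e \in E & u = delta * e.
Proof.
move=> su; exists (u / delta); last by rewrite mulrCA divff ?mulr1 ?delta_neq0.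
by apply/mem_E; rewrite [LHS]fmorph_div [X in X / _]su [X in _ / X]s_delta invrN mulrNN.
Qed.

Lemma sub_half (u : L) : u = (u + s u) / 2 + (u - s u) / 2.
Proof. by field. Qed.

Lemma s_half_sum u : s ((u + s u) / 2) = (u + s u) / 2.
Proof.
have -> : s ((u + s u) / 2) = (s u + s (s u)) / 2 by rewrite fmorph_div rmorphD rmorph_nat.
by rewrite s_squared addrC.
Qed.

Lemma s_half_diff u : s ((u - s u) / 2) = - ((u - s u) / 2).
Proof.
have -> : s ((u - s u) / 2) = (s u - s (s u)) / 2 by rewrite fmorph_div rmorphB rmorph_nat.
by rewrite s_squared -mulNr opprB.
Qed.

(** L = E + delta E is spanned over K by integral elements. This extends [hzb], which speaks only of
    integral elements, to all of F. *)
Lemma clear_denom_integral (u : L) : exists n, I ((3 ^+ n)%:A * u).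
Proof.
pose P (u : L) := exists n, I ((3 ^+ n)%:A * u); rewrite -/(P u).
have PD u1 u2 : P u1 -> P u2 -> P (u1 + u2).
  move=> [n1 I1] [n2 I2]; exists (n1 + n2)%N.
  have O3 n : 3 ^+ n \in O by apply/(Q3_exp hK)/(Q3_natr hK).
  have -> : (3 ^+ (n1 + n2))%:A * (u1 + u2) =
    (3 ^+ n2)%:A * ((3 ^+ n1)%:A * u1) + (3 ^+ n1)%:A * ((3 ^+ n2)%:A * u2).
    by rewrite exprD -!in_algE; ring.
  by integrality hK.
have PM w u' : I w -> P u' -> P (u' * w).
  by move=> Iw [n In]; exists n; rewrite mulrA; integrality hK.
have PK a : P a%:A.
  have [n On] := Q3_clear_denom hK a; exists n.
  have -> : (3 ^+ n)%:A * a%:A = (3 ^+ n * a)%:A :> L by rewrite -!in_algE; ring.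
  by integrality hK.
have Ix := root1_integral hK x3; have Iy := root2_integral hK x3 y2.
have It := root3_integral hK x3 y2 tE.
have PE e : e \in E -> P e.
  case/E_span=> a [b [c ->]].
  exact: PD (PD _ _ (PK a) (PM _ _ Ix (PK b))) (PM _ _ (integral_overX hK 2 Ix) (PK c)).
have Id : I delta by rewrite /delta -/y -/t; integrality hK.
rewrite (sub_half u); apply: PD.
  exact/PE/mem_E/s_half_sum.
have [e Ee ->] := anti_span (s_half_diff u).
by rewrite mulrC; apply: PM (PE _ Ee).
Qed.

Lemma delta_sqr : delta ^+ 2 = (3 * A%:R) ^+ 2 * (3 * B%:R) ^+ 2 - 4 * (3 * B%:R) ^+ 3
   - 4 * (3 * A%:R) ^+ 3 * (3 * C%:R) - 27 * (3 * C%:R) ^+ 2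
   + 18 * (3 * A%:R) * (3 * B%:R) * (3 * C%:R).
Proof. exact: cubic_discriminant x3 y2 tE. Qed.

(** * The quadratic subfield F and its generator z *)

Variables (F : {subfield L}) (z : L).
Hypotheses (hF : \dim F = 2%N) (hz : z \in F) (hz2 : z ^+ 2 \in 1%VS)
  (hzb : forall y, y \in F ->
     (integral_over O y <->
      exists a b, [/\ a \in O, b \in O & y = a%:A + b%:A * z])).

(** Otherwise {1, z} would span only K, while F has dimension 2. *)
Lemma z_notin_K : z \notin 1%VS.
Proof.
apply/negP => z1; have /subvPn[u Fu /negP[]] : ~~ (F <= 1)%VS.
  by apply/negP => /dimvS; rewrite hF dimv1.
have [n In] := clear_denom_integral u.
have F3 : (3 ^+ n)%:A * u \in F by rewrite mulr_algl memvZ.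
case: (hzb F3) => /(_ In)[a [b [_ _ def_u]]] _.
have : (3 ^+ n)%:A * u \in 1%VS by rewrite def_u mulr_algl memvD ?memvZ ?mem1v.
by rewrite mulr_algl rpredZeq expf_eq0 (negPf n3K) andbF.
Qed.

Lemma z_neq0 : z != 0.
Proof. by apply: contraNneq z_notin_K => ->; rewrite mem0v. Qed.

Lemma gal_z (g : gal_of (fullv : {vspace L})) : g z = z \/ g z = - z.
Proof.
have /vlineP[v z2] := hz2.
have : g z ^+ 2 == z ^+ 2 by rewrite -rmorphXn z2 /= linearZ rmorph1.
by rewrite eqf_sqr => /orP[]/eqP; [left | right].
Qed.

(** If r changed the sign of z then so would r^3, which is the identity. *)
Lemma r_z : r z = z.
Proof.
case: (gal_z r) => // rz; have := r_cubed z; have rN u : r (- u) = - r u := rmorphN _ u.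
rewrite rz rN rz opprK rz => /eqP; rewrite eq_sym -addr_eq0 -mulr2n -mulr_natl.
by rewrite mulf_eq0 (negPf n2L) (negPf z_neq0).
Qed.

Lemma s_z : s z = - z.
Proof.
by case: (gal_z s) => // sz; case/negP: z_notin_K; apply: fixed_rs r_z sz.
Qed.

Lemma z_free a b a' b' : a%:A + b%:A * z = a'%:A + b'%:A * z -> a = a' /\ b = b'.
Proof.
move=> eq_ab; have : (b - b')%:A * z = (a' - a)%:A.
  have -> : (b - b')%:A * z = (a' - a)%:A + (a%:A + b%:A * z - (a'%:A + b'%:A * z)).
    by rewrite -!in_algE; ring.
  by rewrite eq_ab subrr addr0.
have [/eqP|nb] := eqVneq (b - b') 0.
  rewrite subr_eq0 => /eqP eq_b; split=> //; apply: (fmorph_inj (in_alg L)).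
  by move: eq_ab; rewrite eq_b => /addIr.
move=> bz; case/negP: z_notin_K.
have : (b - b') *: z \in 1%VS by rewrite -mulr_algl bz memvZ ?mem1v.
by rewrite rpredZeq (negPf nb).
Qed.

Lemma s_anti u : s u = - u -> exists2 e, e \in E & u = z * e.
Proof.
move=> su; exists (u / z); last by rewrite mulrCA divff ?mulr1 ?z_neq0.
by apply/mem_E; rewrite [LHS]fmorph_div [X in X / _]su [X in _ / X]s_z invrN mulrNN.
Qed.

Lemma z_integral : I z.
Proof.
by apply/(hzb hz); exists 0, 1; rewrite (Q3_0 hK) (Q3_1 hK) scale0r add0r scale1r mul1r.
Qed.

(** If 9 divided z^2 then z / 3 would be integral, although {1, z} is a basis of O_F. The two
    alternatives are F unramified and F ramified. *)
Lemma z_sqr : exists v, z ^+ 2 = v%:A /\ (Q3_unit O v \/ Q3_unit O (v / 3)).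
Proof.
have /vlineP[v z2] := hz2; exists v; split=> //; apply: (Q3_order01 hK).
  by apply/(integral_over_alg hK L); rewrite -z2; apply/(integral_overX hK)/z_integral.
apply/negP => Ov9; have Iz3 : I (3^-1 *: z).
  apply: (integral_over_pow hK (n := 1)).
  have -> : (3^-1 *: z) ^+ 2 = (v / 3 ^+ 2)%:A.
    by rewrite exprZn z2 scalerA exprVn mulrC.
  exact: (integral_overA hK).
have Fz3 : 3^-1 *: z \in F by rewrite memvZ.
case: (hzb Fz3) => /(_ Iz3)[a [b [_ Ob]]] + _.
have -> : 3^-1 *: z = 0%:A + (3^-1)%:A * z by rewrite mulr_algl scale0r add0r.
by case/z_free => _ b3; case/negP: (Q3_3nu hK); rewrite b3.
Qed.

(** r fixes [delta] and z, and s negates both, so the quotient lies in K. *)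
Lemma delta_z : exists q, delta = q%:A * z.
Proof.
have /vlineP[q dz] : delta / z \in 1%VS.
  apply: fixed_rs; rewrite [LHS]fmorph_div.
    by rewrite [X in X / _]r_delta [X in _ / X]r_z.
  by rewrite [X in X / _]s_delta [X in _ / X]s_z invrN mulrNN.
by exists q; rewrite -dz divfK ?z_neq0.
Qed.

Lemma F_span w : w \in F -> exists a b, w = a%:A + b%:A * z.
Proof.
move=> Fw; have [n In] := clear_denom_integral w.
have F3 : (3 ^+ n)%:A * w \in F by rewrite mulr_algl memvZ.
case: (hzb F3) => /(_ In)[a [b [_ _ def_w]]] _.
exists (a / 3 ^+ n), (b / 3 ^+ n); have n30 : (3 : K) ^+ n != 0 by rewrite expf_neq0.
apply: (mulfI (_ : (3 ^+ n)%:A != 0 :> L)); first by rewrite scaler_eq0 (negPf n30) oner_eq0.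
by rewrite def_w -!in_algE; field; rewrite fmorph_eq0.
Qed.

(** * Associated orders through the eigenspaces of s *)

Local Notation W := (H1_act r z).

Lemma H1_actE d u : W d u = (d 0 (i3 0))%:A * u
  + (d 0 (i3 1))%:A * (z * (r (r u) - r u)) + (d 0 (i3 2))%:A * (r (r u) + r u).
Proof. by rewrite /H1_act big_ord3 /w_act !val_i3 //= !r_inverse !mulr_algl. Qed.

Fact H1_act_is_linear d : linear (W d).
Proof.
move=> k u v; rewrite !H1_actE !scale_alg.
have rD u' v' : r (in_alg L k * u' + v') = in_alg L k * r u' + r v'.
  by rewrite -!scale_alg linearP.
by rewrite !rD; ring.
Qed.

Lemma H1_actM_z d u : W d (z * u) = z * W d u.
Proof.
have rM w : r (z * w) = z * r w by rewrite [LHS]rmorphM [X in X * _]r_z.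
by rewrite !H1_actE !rM; ring.
Qed.

Lemma H1_act_linear d1 d2 k u : W (k *: d1 + d2) u = k%:A * W d1 u + W d2 u.
Proof. by rewrite !H1_actE !mxE -!in_algE; ring. Qed.

(** Acts by p on E and by m on z E, the eigenspaces of s for 1 and -1. *)
Definition H_endo (p m : 'rV[K]_3) (u : L) : L := W p ((u + s u) / 2) + W m ((u - s u) / 2).

Fact H_endo_is_linear p m : linear (H_endo p m).
Proof.
move=> k u v; rewrite /H_endo linearP.
have -> : (k *: u + v + (k *: s u + s v)) / 2 = k *: ((u + s u) / 2) + (v + s v) / 2.
  by rewrite !scale_alg; field.
have -> : (k *: u + v - (k *: s u + s v)) / 2 = k *: ((u - s u) / 2) + (v - s v) / 2.
  by rewrite !scale_alg; field.
by rewrite !H1_act_is_linear !scale_alg; ring.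
Qed.
HB.instance Definition _ p m :=
  GRing.isLinear.Build K L L *:%R (H_endo p m) (H_endo_is_linear p m).

Definition eigen_plus (c : 'M[K]_(3, 2)) : 'rV[K]_3 := \row_i (c i (i2 0) + c i (i2 1)).
Definition eigen_minus (c : 'M[K]_(3, 2)) : 'rV[K]_3 := \row_i (c i (i2 0) - c i (i2 1)).

(** The stabiliser in H_1 of the lattice M. *)
Definition A_H1z (d : 'rV[K]_3) : Prop :=
  forall e, e \in E -> I (z * e) -> I (z * W d e).

Lemma s_span a b : s (a%:A + b%:A * z) = a%:A - b%:A * z.
Proof.
have sA k : s k%:A = k%:A by rewrite linearZ rmorph1.
have sD : s (a%:A + b%:A * z) = s a%:A + s b%:A * s z by rewrite rmorphD rmorphM.
by rewrite sD !sA s_z mulrN.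
Qed.

Lemma H_acts_span (c : 'M[K]_(3, 2)) a b e :
  \sum_i \sum_j c i j *: (w_act r z i e * eta_act s j (a%:A + b%:A * z)) =
  a%:A * W (eigen_plus c) e + b%:A * (z * W (eigen_minus c) e).
Proof.
rewrite /H1_act !mulr_sumr -big_split; apply: eq_bigr => i _ /=.
rewrite big_ord2 /eta_act !val_i2 //= s_span !mxE !scale_alg; ring.
Qed.

Let half_O : (2 : K)^-1 \in O := Q3_natr_unit hK (isT : ~~ (3 %| 2)%N).

Lemma integral_half u : I u -> I (u / 2 : L).
Proof.
move=> Iu; have -> : u / 2 = 2^-1 *: u by rewrite scale_alg; field.
exact: (integral_overZ hK).
Qed.

(** From left to right, phi is evaluated at e and at z e. Conversely, 2 is a unit, so the
    projections (l + s l) / 2 and (l - s l) / 2 onto E and z E preserve integrality and the two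
    parts can be treated separately. *)
Lemma A_HE (c : 'M[K]_(3, 2)) :
  A_H O r s z E F c <-> A_H1 O r z E (eigen_plus c) /\ A_H1z (eigen_minus c).
Proof.
split=> [[phi [phiE phiI]] | [Ip Im]].
  have {}phiE e a b : e \in E -> phi (e * (a%:A + b%:A * z)) =
      a%:A * W (eigen_plus c) e + b%:A * (z * W (eigen_minus c) e).
    move=> Ee; rewrite -H_acts_span; apply: phiE => //.
    by rewrite mulr_algl memvD ?memvZ ?mem1v.
  split=> e Ee Ie.
    have := phiE e 1 0 Ee; rewrite !scale0r !scale1r !mul0r !addr0 mulr1 mul1r => <-.
    exact: phiI.
  have := phiE e 0 1 Ee; rewrite !scale0r !scale1r !mul0r !add0r !mul1r => <-.
  by rewrite mulrC; apply: phiI.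
exists (linfun (H_endo (eigen_plus c) (eigen_minus c))); split=> [e w Ee /F_span[a [b ->]]|l Il].
  rewrite lfunE H_acts_span /= /H_endo.
  have sE : s (e * (a%:A + b%:A * z)) = e * (a%:A - b%:A * z).
    have -> : s (e * (a%:A + b%:A * z)) = s e * s (a%:A + b%:A * z) by rewrite rmorphM.
    by rewrite s_span (mem_E e).1.
  rewrite sE; have -> : (e * (a%:A + b%:A * z) + e * (a%:A - b%:A * z)) / 2 = a *: e + 0.
    by rewrite !scale_alg; field.
  have -> : (e * (a%:A + b%:A * z) - e * (a%:A - b%:A * z)) / 2 = b *: (z * e) + 0.
    by rewrite !scale_alg; field.
  have W0 d : W d 0 = 0.
    by have := H1_act_is_linear d (-1) 0 0; rewrite scaler0 addr0 scaleN1r addNr.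
  by rewrite !H1_act_is_linear !W0 !addr0 H1_actM_z !mulr_algl.
rewrite lfunE /= /H_endo; have Isl : I (s l) by apply: integral_over_rmorph.
apply: (integral_overD hK).
  by apply: Ip; [apply/mem_E/s_half_sum | apply/integral_half/(integral_overD hK)].
have [e Ee def_u] := s_anti (s_half_diff l).
have Iu : I ((l - s l) / 2) by apply/integral_half/(integral_overB hK).
by rewrite def_u H1_actM_z; apply: Im => //; rewrite -def_u.
Qed.

Lemma A_H1_linear d1 d2 k : k \in O ->
  A_H1 O r z E d1 -> A_H1 O r z E d2 -> A_H1 O r z E (k *: d1 + d2).
Proof.
move=> Ok A1 A2 e Ee Ie; rewrite H1_act_linear.
by have := (A1 e Ee Ie, A2 e Ee Ie) => -[I1 I2]; integrality hK.
Qed.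

Lemma A_H1_0 : A_H1 O r z E 0.
Proof.
move=> e Ee Ie; have := H1_act_linear 0 0 (-1) e; rewrite scaler0 addr0 scaleN1r mulN1r addNr => ->.
exact: (integral_over_nat hK L 0).
Qed.

(** Testing on 1 and on z gives the sum and the difference of the coefficients, and 2 is a unit.
    With [A_H2_delta], this makes the order of F the group ring over O. *)
Lemma A_H2_integral b : A_H2 O s F b -> b 0 (i2 0) \in O /\ b 0 (i2 1) \in O.
Proof.
move=> A2b; have bE u : H2_act s b u = (b 0 (i2 0))%:A * u + (b 0 (i2 1))%:A * s u.
  by rewrite /H2_act big_ord2 /eta_act !val_i2 //= !mulr_algl.
have Op : b 0 (i2 0) + b 0 (i2 1) \in O.
  apply/(integral_over_alg hK L); have := A2b 1 (mem1v _) (integral_over_nat hK L 1).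
  by rewrite bE rmorph1 !mulr1 -scalerDl.
have Om : b 0 (i2 0) - b 0 (i2 1) \in O.
  have := A2b z hz z_integral; rewrite bE s_z mulrN -mulrBl -scalerBl.
  set k := b 0 _ - _ => Ikz; have Fkz : k%:A * z \in F by rewrite mulr_algl memvZ.
  case: (hzb Fkz) => /(_ Ikz)[a [l [_ Ol]]] + _.
  by rewrite -[LHS]add0r -(scale0r 1) => /z_free[_ ->].
have n2K : (2 : K) != 0 := Q3_natr_neq0 hK (isT : 0 < 2)%N.
split.
  have -> : b 0 (i2 0) = 2^-1 * (b 0 (i2 0) + b 0 (i2 1) + (b 0 (i2 0) - b 0 (i2 1))) by field.
  by Q3_closed hK.
have -> : b 0 (i2 1) = 2^-1 * (b 0 (i2 0) + b 0 (i2 1) - (b 0 (i2 0) - b 0 (i2 1))) by field.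
by Q3_closed hK.
Qed.

Lemma A_H2_delta j : A_H2 O s F (delta_mx 0 j).
Proof.
move=> u Fu Iu; rewrite /H2_act (bigD1 j) //= big1 => [|k kj].
  rewrite mxE !eqxx scale1r addr0 /eta_act.
  by case: ifP => // _; apply: integral_over_rmorph.
by rewrite mxE eqxx (negPf kj) scale0r.
Qed.

(** The order of F is free over O on eta_1 and eta_2, so membership in the tensor product is decided
    column by column. *)
Lemma tensorE (c : 'M[K]_(3, 2)) : tensor_AH1_AH2 O r s z E F c <->
  forall j, A_H1 O r z E (col j c)^T.
Proof.
split=> [[n [a [b [A1a A2b ->]]]] j | A1c].
  have Ob k : b k 0 j \in O.
    have [Ob0 Ob1] := A_H2_integral (A2b k).
    by case: (ord2P j) => ->.
  have -> : (col j (\sum_k (a k)^T *m b k))^T = \sum_k b k 0 j *: a k.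
    apply/rowP => i; rewrite !mxE !summxE; apply: eq_bigr => k _.
    by rewrite !mxE big_ord1 !mxE mulrC.
  elim/big_ind: _ => [|d1 d2 A1 A2|k _]; first exact: A_H1_0.
    by rewrite -[d1]scale1r; apply: A_H1_linear => //; apply: Q3_1 hK.
  by rewrite -[_ *: _]addr0; apply: A_H1_linear => //; apply: A_H1_0.
exists 2, (fun j => (col j c)^T), (fun j => delta_mx 0 j); split=> // [j|].
  exact: A_H2_delta.
apply/matrixP => i j; rewrite summxE (bigD1 j) //= big1 => [|k kj].
  by rewrite !mxE big_ord1 !mxE !eqxx mulr1 addr0.
by rewrite !mxE big_ord1 !mxE [j == k]eq_sym (negPf kj) andbF mulr0.
Qed.

(** The two columns and their sum and difference span the same O-module, since 2 is a unit. *)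
Lemma tensor_eigenE (c : 'M[K]_(3, 2)) : tensor_AH1_AH2 O r s z E F c <->
  A_H1 O r z E (eigen_plus c) /\ A_H1 O r z E (eigen_minus c).
Proof.
have O1 := Q3_1 hK; have n2K : (2 : K) != 0 := Q3_natr_neq0 hK (isT : 0 < 2)%N.
rewrite tensorE; split=> [A1c | [Ap Am] j].
  split.
    have -> : eigen_plus c = 1 *: (col (i2 0) c)^T + (col (i2 1) c)^T.
      by apply/rowP => i; rewrite !mxE mul1r.
    exact: A_H1_linear.
  have -> : eigen_minus c = -1 *: (col (i2 1) c)^T + (col (i2 0) c)^T.
    by apply/rowP => i; rewrite !mxE mulN1r addrC.
  by apply: A_H1_linear => //; apply: (Q3_opp hK).
case: (ord2P j) => ->.
  have -> : (col (i2 0) c)^T = 2^-1 *: eigen_plus c + (2^-1 *: eigen_minus c + 0).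
    by apply/rowP => i; rewrite !mxE; field.
  by apply: A_H1_linear => //; apply: A_H1_linear => //; apply: A_H1_0.
have -> : (col (i2 1) c)^T = 2^-1 *: eigen_plus c + (- 2^-1 *: eigen_minus c + 0).
  by apply/rowP => i; rewrite !mxE; field.
apply: A_H1_linear => //; apply: A_H1_linear; [exact: (Q3_opp hK) | done | exact: A_H1_0].
Qed.

(** z is then a unit among the integers of L, so that M = O_E. *)
Lemma H1z_unramified v : z ^+ 2 = v%:A -> Q3_unit O v ->
  forall d, A_H1z d <-> A_H1 O r z E d.
Proof.
move=> z2 [Ov Ovi v0]; have Iz := z_integral.
have IzE e : I (z * e) <-> I e.
  split=> Ie; last exact: (integral_overM hK).
  have -> : e = (v^-1)%:A * (z * (z * e)).
    by rewrite !mulrA -(mulrA _ z z) -expr2 z2 mulr_algl scalerA mulVf // scale1r mul1r.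
  by integrality hK.
by move=> d; split=> Ad e Ee; have := Ad e Ee; rewrite !IzE.
Qed.

Lemma A_H_tensor : (forall d, A_H1z d <-> A_H1 O r z E d) ->
  forall c, A_H O r s z E F c <-> tensor_AH1_AH2 O r s z E F c.
Proof. by move=> eqA c; rewrite A_HE tensor_eigenE eqA. Qed.

Lemma r_span a b c : r (a%:A + b%:A * x + c%:A * x ^+ 2) = a%:A + b%:A * y + c%:A * y ^+ 2.
Proof.
have rA k : r k%:A = k%:A by rewrite linearZ rmorph1.
have rD : r (a%:A + b%:A * x + c%:A * x ^+ 2) = r a%:A + r b%:A * r x + r c%:A * r x ^+ 2.
  by rewrite !rmorphD !rmorphM.
by rewrite rD !rA.
Qed.

Lemma rr_span a b c :
  r (r (a%:A + b%:A * x + c%:A * x ^+ 2)) = a%:A + b%:A * t + c%:A * t ^+ 2.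
Proof.
have rA k : r k%:A = k%:A by rewrite linearZ rmorph1.
have rD : r (a%:A + b%:A * y + c%:A * y ^+ 2) = r a%:A + r b%:A * r y + r c%:A * r y ^+ 2.
  by rewrite !rmorphD !rmorphM.
by rewrite r_span rD !rA ry.
Qed.

(** * Cubics without quadratic term *)

Section Trace0.
Hypothesis A0 : A = 0%N.

Let A0L : (A%:R : L) = 0. Proof. by rewrite A0. Qed.

(* Multiplying by delta = q z turns z (t - y) into a polynomial in x; then p = - 9 / q. *)
Lemma z_sub_roots v : z ^+ 2 = v%:A -> exists p : K,
  z * (t - y) = p%:A * (4 * B%:R ^+ 2 - 3 * C%:R * x + 2 * B%:R * x ^+ 2)
  /\ p ^+ 2 * (4 * B%:R ^+ 3 + 9 * C%:R ^+ 2) = - (3 * v).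
Proof.
move=> z2; have [q def_d] := delta_z; have d0 := delta_neq0.
have q0 : q != 0 by apply: contraNneq d0 => q0; rewrite def_d q0 scale0r mul0r.
have qL0 : in_alg L q != 0 by rewrite fmorph_eq0.
exists (- 9 / q); split.
  have def_z : z = delta / in_alg L q by rewrite def_d -in_algE mulrC mulKf.
  have -> : (- 9 / q)%:A = - 9 / in_alg L q :> L by rewrite -in_algE; field.
  rewrite def_z mulrAC [RHS]mulrAC; congr (_ / _); rewrite /delta.
  rewrite (depressed_cubic_delta x3 _ y2 tE) ?A0L ?mulr0 //; ring.
(* The discriminant, computed once as q^2 z^2 and once from the coefficients. *)
have q2v : q ^+ 2 * v = - (27 * (4 * B%:R ^+ 3 + 9 * C%:R ^+ 2)).
  apply: (fmorph_inj (in_alg L)); transitivity (delta ^+ 2).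
    by rewrite def_d exprMn z2 -!in_algE; ring.
  by rewrite delta_sqr A0L; ring.
have n27 : (27 : K) != 0 := Q3_natr_neq0 hK (isT : 0 < 27)%N.
have -> : 4 * B%:R ^+ 3 + 9 * C%:R ^+ 2 = - (q ^+ 2 * v / 27) by rewrite q2v; field.
by field; rewrite n27.
Qed.

Variables (p v : K).
Hypotheses (z2 : z ^+ 2 = (3 * v)%:A) (Uv : Q3_unit O v)
  (hp : z * (t - y) = p%:A * (4 * B%:R ^+ 2 - 3 * C%:R * x + 2 * B%:R * x ^+ 2)).

(** The matrix of H_1 in the basis 1, x, x^2. The part of w_2 is z (t - y) (b + c (t + y)), where
    [hp] rewrites z (t - y) and t + y = - x. *)
Lemma H1_act_span (d : 'rV[K]_3) a b c :
  let d0 := d 0 (i3 0) in let d1 := d 0 (i3 1) in let d2 := d 0 (i3 2) in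
  W d (a%:A + b%:A * x + c%:A * x ^+ 2) =
    (a * (d0 + 2 * d2) + b * (4 * B%:R ^+ 2 * p * d1)
      + c * (6 * B%:R * C%:R * p * d1 - 6 * B%:R * d2))%:A
    + (b * (d0 - d2 - 3 * C%:R * p * d1) + c * (2 * B%:R ^+ 2 * p * d1))%:A * x
    + (b * (2 * B%:R * p * d1) + c * (d0 - d2 + 3 * C%:R * p * d1))%:A * x ^+ 2.
Proof.
move=> d0 d1 d2; rewrite H1_actE rr_span r_span -/d0 -/d1 -/d2.
have -> : z * (a%:A + b%:A * t + c%:A * t ^+ 2 - (a%:A + b%:A * y + c%:A * y ^+ 2)) =
    z * (t - y) * (b%:A + c%:A * (t + y)) by ring.
rewrite hp -!in_algE; have := y2 => y2; have := tE => tE.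
by ring: x3 y2 tE A0L.
Qed.

Let O_lattice a b c :
  I (a%:A + b%:A * x + c%:A * x ^+ 2) <-> [/\ a \in O, b \in O & c \in O].
Proof. exact: (Eisenstein_integralE hK C_ndvd3 x3 y2 tE). Qed.

Let z_lattice a b c :
  I (z * (a%:A + b%:A * x + c%:A * x ^+ 2)) <-> [/\ a \in O, b \in O & 3 * c \in O].
Proof.
case: Uv => Ov Ovi v0.
exact: (Eisenstein_ramifiedE hK C_ndvd3 x3 y2 tE a b c Ov Ovi v0 z2).
Qed.

Let E_mem a b c : a%:A + b%:A * x + c%:A * x ^+ 2 \in E.
Proof.
have Ex : x \in E := memv_adjoin _ _.
by rewrite !mulr_algl !memvD ?memvZ ?mem1v //; apply: rpredX.
Qed.

(** The three groups are the coordinates of the images of 1, x and x^2; the image of 1 is a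
    scalar. *)
Lemma A_H1_coords (d : 'rV[K]_3) :
  let d0 := d 0 (i3 0) in let d1 := d 0 (i3 1) in let d2 := d 0 (i3 2) in
  A_H1 O r z E d <->
  [/\ d0 + 2 * d2 \in O,
      [/\ 4 * B%:R ^+ 2 * p * d1 \in O, d0 - d2 - 3 * C%:R * p * d1 \in O
        & 2 * B%:R * p * d1 \in O]
    & [/\ 6 * B%:R * C%:R * p * d1 - 6 * B%:R * d2 \in O, 2 * B%:R ^+ 2 * p * d1 \in O
        & d0 - d2 + 3 * C%:R * p * d1 \in O]].
Proof.
move=> d0 d1 d2; have O1 := Q3_1 hK; have O0 := Q3_0 hK.
split=> [Ad | [? [? ? ?] [? ? ?]] e /E_span[a [b [c ->]]] /O_lattice[Oa Ob Oc]]; last first.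
  by rewrite H1_act_span; apply/O_lattice; split; Q3_closed hK.
have img a b c : a \in O -> b \in O -> c \in O -> _ :=
  fun Oa Ob Oc => Ad _ (E_mem a b c) ((O_lattice a b c).2 (And3 Oa Ob Oc)).
split.
- by have := img 1 0 0 O1 O0 O0; rewrite H1_act_span => /O_lattice[]; rewrite !mul0r !addr0 mul1r.
- have := img 0 1 0 O0 O1 O0; rewrite H1_act_span => /O_lattice[].
  by rewrite !mul0r !addr0 !add0r !mul1r.
have := img 0 0 1 O0 O0 O1; rewrite H1_act_span => /O_lattice[].
by rewrite !mul0r !add0r !mul1r.
Qed.

(** The same for the basis 1, x, x^2 / 3 of M: coordinates along x^2 are multiplied by 3, and the
    image of x^2 is divided by 3. *)
Lemma A_H1z_coords (d : 'rV[K]_3) :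
  let d0 := d 0 (i3 0) in let d1 := d 0 (i3 1) in let d2 := d 0 (i3 2) in
  A_H1z d <->
  [/\ d0 + 2 * d2 \in O,
      [/\ 4 * B%:R ^+ 2 * p * d1 \in O, d0 - d2 - 3 * C%:R * p * d1 \in O
        & 6 * B%:R * p * d1 \in O]
    & [/\ 2 * B%:R * C%:R * p * d1 - 2 * B%:R * d2 \in O, 2 * B%:R ^+ 2 * p * d1 / 3 \in O
        & d0 - d2 + 3 * C%:R * p * d1 \in O]].
Proof.
move=> d0 d1 d2; have O1 := Q3_1 hK; have O0 := Q3_0 hK; have O3 := Q3_natr hK 3.
split=> [Ad | [Oi [Ox0 Ox1 Ox2] [Oy0 Oy1 Oy2]] e /E_span[a [b [c ->]]] /z_lattice[Oa Ob Oc]].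
  have img a b c : a \in O -> b \in O -> 3 * c \in O -> _ :=
    fun Oa Ob Oc => Ad _ (E_mem a b c) ((z_lattice a b c).2 (And3 Oa Ob Oc)).
  have O33 : 3 * 3^-1 \in O by rewrite divff.
  have O30 : 3 * 0 \in O by rewrite mulr0.
  split.
  - have := img 1 0 0 O1 O0 O30; rewrite H1_act_span => /z_lattice[].
    by rewrite !mul0r !addr0 mul1r.
  - have := img 0 1 0 O0 O1 O30; rewrite H1_act_span => /z_lattice[].
    rewrite !mul0r !addr0 !add0r !mul1r => ? ? Oz; split=> //.
    by have -> : 6 * B%:R * p * d1 = 3 * (2 * B%:R * p * d1) by ring.
  have := img 0 0 3^-1 O0 O0 O33; rewrite H1_act_span => /z_lattice[].
  rewrite !mul0r !add0r => Oy0 Oy1 Oy2; split.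
  - suff -> : 2 * B%:R * C%:R * p * d1 - 2 * B%:R * d2 =
      3^-1 * (6 * B%:R * C%:R * p * d1 - 6 * B%:R * d2) by [].
    by field.
  - by rewrite mulrC.
  by move: Oy2; rewrite mulrA divff // mul1r.
rewrite H1_act_span; apply/z_lattice; split.
- have -> : c * (6 * B%:R * C%:R * p * d 0 (i3 1) - 6 * B%:R * d 0 (i3 2)) =
    3 * c * (2 * B%:R * C%:R * p * d1 - 2 * B%:R * d2) by rewrite /d1 /d2; ring.
  by Q3_closed hK.
- have -> : c * (2 * B%:R ^+ 2 * p * d 0 (i3 1)) =
    3 * c * (2 * B%:R ^+ 2 * p * d1 / 3) by rewrite /d1; field.
  by Q3_closed hK.
have -> : 3 * (b * (2 * B%:R * p * d 0 (i3 1))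
    + c * (d 0 (i3 0) - d 0 (i3 2) + 3 * C%:R * p * d 0 (i3 1))) =
  b * (6 * B%:R * p * d1) + 3 * c * (d0 - d2 + 3 * C%:R * p * d1) by rewrite /d0 /d1 /d2; ring.
by Q3_closed hK.
Qed.

(** Every off-diagonal coordinate carries a factor B, and the diagonal conditions of the two
    lattices agree. *)
Lemma H1z_pure : B = 0%N -> forall d, A_H1z d <-> A_H1 O r z E d.
Proof.
by move=> B0 d; rewrite A_H1_coords A_H1z_coords B0 !(expr0n, mulr0, mul0r, subr0, addr0).
Qed.

Section Binomial.
Hypotheses (UB : Q3_unit O B%:R) (Up : Q3_unit O (p / 3)).

(** As 2, B and p / 3 are units, the condition on 2 B p d1 is one on 3 d1. The diagonal then gives
    d0 - d2, and the image of 1 gives 3 d2. *)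
Lemma H1_mixedE (d : 'rV[K]_3) : A_H1 O r z E d <->
  [/\ 3 * d 0 (i3 1) \in O, d 0 (i3 0) - d 0 (i3 2) \in O & 3 * d 0 (i3 2) \in O].
Proof.
rewrite A_H1_coords; move: (d 0 (i3 0)) (d 0 (i3 1)) (d 0 (i3 2)) => d0 d1 d2.
have OC := Q3_natr hK C; have OB := Q3_natr hK B; have [Op3 Opi p30] := Up.
have U2 := Q3_natr_is_unit hK (isT : ~~ (3 %| 2)%N).
split=> [[Oi [_ Ox1 Ox2] [_ _ Oy2]] | [O1 O02 O2]].
  have O1 : 3 * d1 \in O.
    apply: (Q3_unit_mulI hK Up); apply: (Q3_unit_mulI hK UB); apply: (Q3_unit_mulI hK U2).
    by have -> : 2 * (B%:R * (p / 3 * (3 * d1))) = 2 * B%:R * p * d1 by field.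
  have O02 : d0 - d2 \in O.
    have -> : d0 - d2 = d0 - d2 + 3 * C%:R * p * d1 - 3 * C%:R * (p / 3) * (3 * d1) by field.
    by Q3_closed hK.
  split=> //; have -> : 3 * d2 = d0 + 2 * d2 - (d0 - d2) by ring.
  by Q3_closed hK.
have Opd : p * d1 \in O.
  have -> : p * d1 = p / 3 * (3 * d1) by field.
  by Q3_closed hK.
split; [|split|split]; rewrite -?mulrA.
- have -> : d0 + 2 * d2 = d0 - d2 + 3 * d2 by ring.
  by Q3_closed hK.
- by Q3_closed hK.
- by Q3_closed hK.
- by Q3_closed hK.
- have -> : 6 * (B%:R * (C%:R * (p * d1))) - 6 * (B%:R * d2) =
    6 * (B%:R * (C%:R * (p * d1))) - 2 * B%:R * (3 * d2) by ring.
  by Q3_closed hK.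
- by Q3_closed hK.
by Q3_closed hK.
Qed.

(** In the image of x^2 / 3 the coordinate along x is a unit times d1, so d1 is in O; the constant
    coordinate then gives d2, and the image of 1 gives d0. *)
Lemma H1z_mixedE (d : 'rV[K]_3) : A_H1z d <->
  [/\ d 0 (i3 0) \in O, d 0 (i3 1) \in O & d 0 (i3 2) \in O].
Proof.
rewrite A_H1z_coords; move: (d 0 (i3 0)) (d 0 (i3 1)) (d 0 (i3 2)) => d0 d1 d2.
have OC := Q3_natr hK C; have OB := Q3_natr hK B; have [Op3 Opi p30] := Up.
have U2 := Q3_natr_is_unit hK (isT : ~~ (3 %| 2)%N).
have Op : p \in O.
  have -> : p = 3 * (p / 3) by field.
  by Q3_closed hK.
split=> [[Oi _ [Oy0 Oy1 _]] | [O0 O1 O2]].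
  have O1 : d1 \in O.
    do 2![apply: (Q3_unit_mulI hK UB)]; apply: (Q3_unit_mulI hK U2); apply: (Q3_unit_mulI hK Up).
    by have -> : p / 3 * (2 * (B%:R * (B%:R * d1))) = 2 * B%:R ^+ 2 * p * d1 / 3 by field.
  have O2 : d2 \in O.
    apply: (Q3_unit_mulI hK UB); apply: (Q3_unit_mulI hK U2).
    have -> : 2 * (B%:R * d2) = 2 * B%:R * C%:R * p * d1
       - (2 * B%:R * C%:R * p * d1 - 2 * B%:R * d2) by ring.
    by Q3_closed hK.
  split=> //; have -> : d0 = d0 + 2 * d2 - 2 * d2 by ring.
  by Q3_closed hK.
have e1 : 2 * B%:R ^+ 2 * p * d1 / 3 = 2 * B%:R ^+ 2 * (p / 3) * d1 by field.
by split; [|split|split]; rewrite ?e1; Q3_closed hK.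
Qed.

Lemma A_H_mixedE (c : 'M[K]_(3, 2)) : A_H O r s z E F c <->
  exists lam : 'I_6 -> K, (forall k, lam k \in O) /\ c = \sum_k lam k *: basisAH K k.
Proof.
have O3 := Q3_natr hK 3; rewrite A_HE H1_mixedE H1z_mixedE !mxE.
have n2K : (2 : K) != 0 := Q3_natr_neq0 hK (isT : 0 < 2)%N.
set c00 := c (i3 0) (i2 0); set c01 := c (i3 0) (i2 1); set c10 := c (i3 1) (i2 0).
set c11 := c (i3 1) (i2 1); set c20 := c (i3 2) (i2 0); set c21 := c (i3 2) (i2 1).
split=> [[[Op1 Op02 Op2] [Om0 Om1 Om2]] | [lam [Olam def_c]]].
  (* The solution of the equations of [basisAH_sum]: the entries of c at w_2 eta_2 and w_3 eta_2 fix
     the two coefficients with denominator 3. *)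
  pose lam := [:: c00 - c21; c01 - c21; c10 - c11; 3 * c11; c20 - c21; 3 * c21].
  exists (fun k : 'I_6 => nth 0 lam k); split.
    have O02 : c00 - c20 \in O.
      have -> : c00 - c20 = 2^-1 * (c00 + c01 - (c20 + c21) + (c00 - c01) - (c20 - c21)).
        by field.
      by Q3_closed hK.
    case=> [[|[|[|[|[|[|//]]]]]] ltk] /=; rewrite ?Om1 ?Om2 //.
    - have -> : c00 - c21 = c00 - c20 + (c20 - c21) by ring.
      by Q3_closed hK.
    - have -> : c01 - c21 = c00 - c20 + (c20 - c21) - (c00 - c01) by ring.
      by Q3_closed hK.
    - have -> : 3 * c11 = 2^-1 * (3 * (c10 + c11) - 3 * (c10 - c11)) by field.
      by Q3_closed hK.
    have -> : 3 * c21 = 2^-1 * (3 * (c20 + c21) - 3 * (c20 - c21)) by field.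
    by Q3_closed hK.
  apply/matrixP => i j; have [] := basisAH_sum (fun k : 'I_6 => nth 0 lam k).
  rewrite !inordK //= => e00 e01 e10 e11 [e20 e21].
  by case: (ord3P i) => ->; case: (ord2P j) => ->;
    rewrite ?e00 ?e01 ?e10 ?e11 ?e20 ?e21 -/c00 -/c01 -/c10 -/c11 -/c20 -/c21; field.
have [] := basisAH_sum lam; rewrite -def_c -/c00 -/c01 -/c10 -/c11 -/c20 -/c21.
move=> -> -> -> -> [-> ->]; move: (Olam (inord 0)) (Olam (inord 1)) (Olam (inord 2))
  (Olam (inord 3)) (Olam (inord 4)) (Olam (inord 5)).
move: (lam (inord 0)) (lam (inord 1)) (lam (inord 2)) (lam (inord 3)) (lam (inord 4))
  (lam (inord 5)) => l0 l1 l2 l3 l4 l5 O0 O1 O2 O3' O4 O5.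
split; split.
- have -> : 3 * (l2 + l3 / 3 + l3 / 3) = 3 * l2 + 2 * l3 by field.
  by Q3_closed hK.
- have -> : l0 + l5 / 3 + (l1 + l5 / 3) - (l4 + l5 / 3 + l5 / 3) = l0 + l1 - l4 by ring.
  by Q3_closed hK.
- have -> : 3 * (l4 + l5 / 3 + l5 / 3) = 3 * l4 + 2 * l5 by field.
  by Q3_closed hK.
- have -> : l0 + l5 / 3 - (l1 + l5 / 3) = l0 - l1 by ring.
  by Q3_closed hK.
- by rewrite addrK.
by rewrite addrK.
Qed.

(** The witness is (w_2 / 3) eta_1: w_2 / 3 preserves O_E but not M. *)
Lemma A_H_neq_tensor : ~ (forall c, A_H O r s z E F c <-> tensor_AH1_AH2 O r s z E F c).
Proof.
pose d : 'rV[K]_3 := \row_i (if val i == 1%N then 3^-1 else 0).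
have A1d : A_H1 O r z E d.
  rewrite H1_mixedE !mxE !val_i3 //= subrr mulr0 divff //.
  by split; Q3_closed hK.
move/(_ (d^T *m delta_mx 0 (i2 0))) => [_ tensA].
have {tensA} : A_H O r s z E F (d^T *m delta_mx 0 (i2 0)).
  apply: tensA; exists 1%N, (fun=> d), (fun=> delta_mx 0 (i2 0)).
  by split=> // [_|]; [apply: A_H2_delta | rewrite big_ord1].
rewrite A_HE => -[_ /H1z_mixedE[_ + _]].
rewrite !mxE !big_ord1 !mxE !val_i3 //= -!val_eqE /= !val_i2 //= mulr1 mulr0 subr0.
by rewrite (negPf (Q3_3nu hK)).
Qed.

End Binomial.
End Trace0.

(** * The three families of cubics *)

Let A_H_tensor_stmt := forall c, A_H O r s z E F c <-> tensor_AH1_AH2 O r s z E F c.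

(** The relation (3 p)^2 C^2 = - 3 v excludes a unit v by parity, so F is ramified. *)
Lemma A_H_pure_cubic : A = 0%N -> B = 0%N -> A_H_tensor_stmt.
Proof.
move=> A0 B0; have [v [z2 Uv]] := z_sqr; have [p [hp p2]] := z_sub_roots A0 z2.
have UC := Q3_natr_is_unit hK C_ndvd3.
case: Uv => Uv.
  have := Q3_sqr_odd hK (w := 3 * p) (Q3_unitX hK 2 UC) (Q3_unitN hK Uv); case.
  by rewrite mulrN -p2 B0; ring.
have def_v : v = 3 * (v / 3) by field.
rewrite def_v in z2; apply: A_H_tensor; exact: (H1z_pure A0 z2 Uv hp B0).
Qed.

Lemma A_H_unramified : A = 1%N -> B = 0%N -> C = 1%N -> A_H_tensor_stmt.
Proof.
(* The discriminant - 567 = - 3^4 * 7 has even valuation. *)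
move=> A1 B0 C1; have [v [z2 Uv]] := z_sqr; apply: A_H_tensor.
case: Uv => Uv; first exact: H1z_unramified z2 Uv.
have [q def_d] := delta_z.
have q2v : q ^+ 2 * v = - 567.
  apply: (fmorph_inj (in_alg L)); transitivity (delta ^+ 2).
    by rewrite def_d exprMn z2 -!in_algE; ring.
  by rewrite delta_sqr A1 B0 C1; ring.
have n27 : (27 : K) != 0 := Q3_natr_neq0 hK (isT : 0 < 27)%N.
have U7 := Q3_unitN hK (Q3_natr_is_unit hK (isT : ~~ (3 %| 7)%N)).
(* If v / 3 were a unit, (q / 3)^2 (v / 3) = - 21 would contradict parity. *)
have := Q3_sqr_odd hK (w := q / 3) Uv U7; case.
have -> : (q / 3) ^+ 2 * (v / 3) = q ^+ 2 * v / 27 by field; rewrite n27 n3K.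
by rewrite q2v; field; rewrite n27.
Qed.

(** D = 4 B^3 + 9 C^2 is a unit because B is. From p^2 D = - 3 v, parity excludes a unit v, and then
    (p / 3)^2 D = - v / 3 makes p / 3 a unit. *)
Lemma A_H_mixed_cubic : A = 0%N -> ~~ (3 %| B)%N -> ~ A_H_tensor_stmt /\
  forall c, A_H O r s z E F c <->
    exists lam : 'I_6 -> K, (forall k, lam k \in O) /\ c = \sum_k lam k *: basisAH K k.
Proof.
move=> A0 B_ndvd3; have [v [z2 Uv]] := z_sqr; have [p [hp p2]] := z_sub_roots A0 z2.
have UB := Q3_natr_is_unit hK B_ndvd3.
have UD : Q3_unit O (4 * B%:R ^+ 3 + 9 * C%:R ^+ 2).
  have -> : 4 * B%:R ^+ 3 + 9 * C%:R ^+ 2 = (4 * B ^ 3 + 9 * C ^ 2)%:R :> K.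
    by rewrite natrD (natrM _ 4) (natrM _ 9) !natrX.
  apply: (Q3_natr_is_unit hK); rewrite dvdn_addl; last by rewrite dvdn_mulr.
  by rewrite Euclid_dvdM // Euclid_dvdX // (negPf B_ndvd3).
case: Uv => Uv.
  by have := Q3_sqr_odd hK (w := p) UD (Q3_unitN hK Uv); rewrite p2 mulrN.
have def_v : v = 3 * (v / 3) by field.
rewrite def_v in z2.
have Up : Q3_unit O (p / 3).
  apply: (Q3_sqr_unit hK UD (Q3_unitN hK Uv)).
  have -> : (p / 3) ^+ 2 * (4 * B%:R ^+ 3 + 9 * C%:R ^+ 2) =
    p ^+ 2 * (4 * B%:R ^+ 3 + 9 * C%:R ^+ 2) / 9.
    by field; rewrite (Q3_natr_neq0 hK (isT : 0 < 9)%N) n3K.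
  by rewrite p2; field; rewrite (Q3_natr_neq0 hK (isT : 0 < 9)%N) n3K.
split; first exact: (A_H_neq_tensor A0 z2 Uv hp UB Up).
exact: (A_H_mixedE A0 z2 Uv hp UB Up).
Qed.

End GaloisSetup.

(** * The six polynomials *)

Lemma root_cubicE (K : fieldType) (L : fieldExtType K) (a b c : nat) (x : L) :
  root (map_poly (in_alg L) ('X^3 + a%:R%:P * 'X^2 + b%:R%:P * 'X + c%:R%:P)) x ->
  x ^+ 3 = - (a%:R * x ^+ 2 + b%:R * x + c%:R).
Proof.
rewrite /root !(rmorphD, rmorphM) /= !map_polyX !map_polyC !hornerE /= -!in_algE => /eqP px.
by apply/eqP; rewrite -addr_eq0; apply/eqP; rewrite -[RHS]px; ring.
Qed.

Theorem mainTheorem11 (K : fieldType) (O : {pred K}) (hK : Q3_structure O)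
  (f : {poly K})
  (hf : f \in [:: 'X^3 + 3%:P; 'X^3 + 12%:P; 'X^3 + 21%:P;
                 'X^3 + 3%:P * 'X + 3%:P; 'X^3 + 6%:P * 'X + 3%:P;
                 'X^3 + 3%:P * 'X^2 + 3%:P])
  (L : splittingFieldType K)
  (hL : splittingFieldFor 1%VS (map_poly (in_alg L) f) fullv)
  (alpha : L) (halpha : root (map_poly (in_alg L) f) alpha)
  (r s : gal_of (fullv : {vspace L}))
  (hr : #[r]%g = 3%N) (hs : #[s]%g = 2%N) (hsr : (s * r = r ^+ 2 * s)%g)
  (hgen : <<[set r; s]>>%g = 'Gal(fullv / 1%VS)%g)
  (hE : <<1; alpha>>%VS = fixedField <[s]>%g)
  (F : {subfield L}) (hF : \dim F = 2%N)
  (z : L) (hz : z \in F) (hz2 : z ^+ 2 \in 1%VS)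
  (hzb : forall y, y \in F ->
     (integral_over O y <->
      exists a b, [/\ a \in O, b \in O & y = a%:A + b%:A * z])) :
  let E := <<1; alpha>>%VS in
  (f \in [:: 'X^3 + 3%:P; 'X^3 + 12%:P; 'X^3 + 21%:P; 'X^3 + 3%:P * 'X^2 + 3%:P] ->
     forall c, A_H O r s z E F c <-> tensor_AH1_AH2 O r s z E F c) /\
  (f \in [:: 'X^3 + 3%:P * 'X + 3%:P; 'X^3 + 6%:P * 'X + 3%:P] ->
     [/\ ~ (forall c, A_H O r s z E F c <-> tensor_AH1_AH2 O r s z E F c),
         forall c, A_H O r s z E F c <->
           exists lam : 'I_6 -> K, (forall k, lam k \in O) /\
             c = \sum_k lam k *: basisAH K k
       & forall lam : 'I_6 -> K, (forall k, lam k \in O) ->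
           \sum_k lam k *: basisAH K k = 0 -> forall k, lam k = 0]).
Proof.
move=> E; pose cubic (a b c : nat) : {poly K} :=
  'X^3 + a%:R%:P * 'X^2 + b%:R%:P * 'X + c%:R%:P.
have alpha3 A B C : f = cubic (3 * A)%N (3 * B)%N (3 * C)%N ->
    alpha ^+ 3 = - (3 * A%:R * alpha ^+ 2 + 3 * B%:R * alpha + 3 * C%:R).
  by move=> def_f; move: halpha; rewrite def_f => /root_cubicE; rewrite !natrM.
have cubic0 c : 'X^3 + c%:R%:P = cubic 0%N 0%N c by rewrite /cubic !polyC0 !mul0r !addr0.
have cubic1 b c : 'X^3 + b%:R%:P * 'X + c%:R%:P = cubic 0%N b c.
  by rewrite /cubic polyC0 mul0r addr0.
have cubic2 a c : 'X^3 + a%:R%:P * 'X^2 + c%:R%:P = cubic a 0%N c.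
  by rewrite /cubic polyC0 mul0r addr0.
(* C = 1, 4, 7 give the constant terms 3, 12, 21. *)
have pure C : ~~ (3 %| C)%N -> f = 'X^3 + (3 * C)%:R%:P ->
    forall c, A_H O r s z E F c <-> tensor_AH1_AH2 O r s z E F c.
  move=> C_ndvd3; rewrite cubic0 => /(alpha3 0%N 0%N) x3.
  exact: (A_H_pure_cubic hK C_ndvd3 x3 hr hs hsr hgen hE hF hz hz2 hzb).
split; rewrite !inE.
  case/or4P=> /eqP def_f.
  - exact: (pure 1%N).
  - exact: (pure 4%N).
  - exact: (pure 7%N).
  move: def_f; rewrite (cubic2 3%N 3%N) => /(alpha3 1%N 0%N 1%N) x3.
  exact: (A_H_unramified hK _ x3 hr hs hsr hgen hE hF hz hz2 hzb).
move=> f_mixed; have [B B_ndvd3 def_f] :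
    exists2 B, ~~ (3 %| B)%N & f = cubic 0%N (3 * B)%N (3 * 1)%N.
  by case/orP: f_mixed => /eqP->; [exists 1%N | exists 2%N]; rewrite // -cubic1.
have [neq AHE] := A_H_mixed_cubic hK (isT : ~~ (3 %| 1)%N) (alpha3 0%N B 1%N def_f)
  hr hs hsr hgen hE hF hz hz2 hzb erefl B_ndvd3.
by split=> // lam _; apply/basisAH_free/(Q3_3nz hK).
Qed.
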